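(* Let $(\vartheta,\nabla)$ be a strong symmetric Poisson structure on a smooth manifold $M$. Then its characteristic module $\mathcal{F}_\vartheta=\{\vartheta(\alpha)\,|\,\alpha\in\Omega^1(M)\}\subseteq\mathfrak{X}(M)$ is involutive, i.e. closed under the Lie bracket of vector fields.
   Context: A symmetric bivector field $\vartheta\in\Gamma(\mathrm{Sym}^2TM)$ is viewed as a map $\vartheta:T^*M\to TM$ by $\beta(\vartheta(\alpha))=\vartheta(\alpha,\beta)$. Put $\{f,h\}:=\vartheta(\mathrm{d}f,\mathrm{d}h)$, $X_f:=\vartheta(\mathrm{d}f)$ for $f,h\in C^\infty(M)$. For a torsion-free affine connection $\nabla$ on $M$, put $[X,Y]_s:=\nabla_XY+\nabla_YX$ for vector fields. The pair $(\vartheta,\nabla)$ is a strong symmetric Poisson structure if $X_{\{f,h\}}=[X_f,X_h]_s$ for all $f,h\in C^\infty(M)$. *)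

(* Defs.v *)
From HB Require Import structures.
From mathcomp Require Import all_boot all_order all_algebra.
From mathcomp Require Import all_classical all_reals.
From mathcomp Require Import topology normedtype derive.
From mathcomp Require Import ring.

Set Implicit Arguments.
Unset Strict Implicit.
Unset Printing Implicit Defensive.

Import Order.TTheory GRing.Theory Num.Theory.
Import numFieldNormedType.Exports.

Local Open Scope classical_set_scope.
Local Open Scope ring_scope.

Section Smooth.
Context {R : realType} {n : nat}.
Implicit Types (U : set 'rV[R]_n) (f g : 'rV[R]_n -> R) (k : nat).

(* Only meaningful for open U: the derivatives are those of the total function
   f, which on an open set depend only on the values of f on U. *)
Fixpoint Ck k U f : Prop :=
  (forall x, U x -> {for x, continuous f}) /\
  match k with
  | 0%N => True
  | k'.+1 => forall i : 'I_n,
      (forall x, U x -> derivable f x 'e_i) /\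
      Ck k' U (fun x => 'D_'e_i f x)
  end.

Definition smooth_on U f := forall k, Ck k U f.

Lemma CkW k U f : Ck k.+1 U f -> Ck k U f.
Proof.
elim: k f => [|k IH] f; first by case.
case=> fc fd; split=> // i; have [di dC] := fd i; split=> //.
exact: IH.
Qed.

Lemma eq_Ck k U f g : open U -> (forall x, U x -> f x = g x) ->
  Ck k U f -> Ck k U g.
Proof.
move=> oU; elim: k f g => [|k IH] f g fg Hf.
all: have nfg x : U x -> \near x, f x = g x
  by (move=> Ux; apply: filterS (open_nbhs_nbhs (conj oU Ux)) => y /fg).
all: have gc x : U x -> {for x, continuous g}
  by (move=> Ux; change (g @ x --> g x); rewrite -(fg _ Ux);
      exact: cvg_trans (near_eq_cvg (nfg _ Ux)) (Hf.1 _ Ux)).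
  by [].
split=> // i; have [di dC] := Hf.2 i; split.
  by move=> x Ux; apply: near_eq_derivable (nfg _ Ux) (di _ Ux).
by apply: IH dC => x Ux; apply: near_eq_derive; exact: nfg.
Qed.

Lemma Ck_cst k U (c : R) : Ck k U (fun=> c).
Proof.
elim: k c => [|k IH] c; (split; first by move=> x _; exact: cst_continuous) => //.
move=> i; split; first by move=> x _; exact: derivable_cst.
suff -> : (fun x : 'rV[R]_n => 'D_'e_i (fun=> c) x) = fun=> (0 : R) by exact: IH.
by apply/funext => x; exact: derive_cst.
Qed.

Lemma CkD k U f g : open U -> Ck k U f -> Ck k U g -> Ck k U (f + g).
Proof.
move=> oU; elim: k f g => [|k IH] f g [fc fd] [gc gd];
  (split; first by move=> x Ux; exact: continuousD (fc x Ux) (gc x Ux)) => //.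
move=> i; have [dfi dfC] := fd i; have [dgi dgC] := gd i; split.
  by move=> x Ux; apply: derivableD; [exact: dfi|exact: dgi].
apply: eq_Ck (IH _ _ dfC dgC) => // x Ux.
by rewrite deriveD //; [exact: dfi|exact: dgi].
Qed.

Lemma CkM k U f g : open U -> Ck k U f -> Ck k U g -> Ck k U (f * g).
Proof.
move=> oU; elim: k f g => [|k IH] f g Hf Hg.
  split=> // x Ux; exact: continuousM (Hf.1 x Ux) (Hg.1 x Ux).
have [[fc fd] [gc gd]] := (Hf, Hg); split.
  by move=> x Ux; exact: continuousM (fc x Ux) (gc x Ux).
move=> i; have [dfi dfC] := fd i; have [dgi dgC] := gd i; split.
  by move=> x Ux; apply: derivableM; [exact: dfi|exact: dgi].
apply: eq_Ck (CkD oU (IH _ _ (CkW Hf) dgC) (IH _ _ (CkW Hg) dfC)) => // x Ux.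
by rewrite deriveM //; [exact: dfi|exact: dgi].
Qed.

End Smooth.

Section Manifold.
Variables (R : realType) (n : nat).

(* A homeomorphism [coord] from the open set [dom] onto an open subset of R^n,
   with inverse [param]; both functions are total, with irrelevant values
   outside [dom] and [coord @` dom]. *)
Record chart (T : topologicalType) := Chart {
  dom : set T;
  coord : T -> 'rV[R]_n;
  param : 'rV[R]_n -> T;
  dom_open : open dom;
  codom_open : open (coord @` dom);
  coordK : forall p, dom p -> param (coord p) = p;
  coord_continuous : forall p, dom p -> {for p, continuous coord};
  param_continuous :
    forall x, (coord @` dom) x -> {for x, continuous param} }.

Record smooth_manifold := SmoothManifold {
  carrier :> topologicalType;
  carrier_hausdorff : hausdorff_space carrier;
  carrier_second_countable : @second_countable carrier;
  atlas : set (chart carrier);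
  atlas_cover : forall p : carrier, exists2 c, atlas c & dom c p;
  atlas_compatible : forall c d, atlas c -> atlas d -> forall i : 'I_n,
    smooth_on (coord c @` (dom c `&` dom d))
              (fun x => coord d (param c x) 0 i) }.

End Manifold.

Section SmoothFunctions.
Context {R : realType} {n : nat} (M : smooth_manifold R n).

Definition smooth (f : M -> R) : Prop :=
  forall c, atlas c -> smooth_on (coord c @` dom c) (f \o param c).

Definition smooth_pred : {pred M -> R} := mem [set f | smooth f].

Record Cinf := MkCinf {
  Cinf_fun :> M -> R;
  Cinf_subproof : Cinf_fun \in smooth_pred }.

HB.instance Definition _ := [isSub for Cinf_fun].
HB.instance Definition _ := [Choice of Cinf by <:].

Lemma smooth_cst (a : R) : smooth (fun=> a).
Proof. by move=> c _ k; exact: Ck_cst. Qed.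

Lemma smoothD f g : smooth f -> smooth g -> smooth (f + g).
Proof.
move=> sf sg c ac k.
exact: (CkD (codom_open (c := c)) (sf c ac k) (sg c ac k)).
Qed.

Lemma smoothM f g : smooth f -> smooth g -> smooth (f * g).
Proof.
move=> sf sg c ac k.
exact: (CkM (codom_open (c := c)) (sf c ac k) (sg c ac k)).
Qed.

Lemma smoothZ a f : smooth f -> smooth (a *: f).
Proof. by move=> sf; apply: (smoothM (smooth_cst a)). Qed.

Lemma smoothB f g : smooth f -> smooth g -> smooth (f - g).
Proof.
by move=> sf sg; rewrite -scaleN1r; apply: smoothD => //; exact: smoothZ.
Qed.

Lemma smooth_subring_closed : subring_closed smooth_pred.
Proof.
split=> [|f g|f g]; rewrite ?inE /=.
- exact: smooth_cst.
- exact: smoothB.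
- exact: smoothM.
Qed.

Lemma smooth_subsemimod_closed : subsemimod_closed smooth_pred.
Proof.
split; first split=> [|f g]; rewrite ?inE /=.
- exact: smooth_cst.
- exact: smoothD.
- by move=> a f; rewrite !inE; exact: smoothZ.
Qed.

HB.instance Definition _ :=
  GRing.SubChoice_isSubComPzRing.Build _ smooth_pred Cinf smooth_subring_closed.
HB.instance Definition _ :=
  GRing.SubZmodule_isSubLmodule.Build R (M -> R) smooth_pred Cinf
    smooth_subsemimod_closed.

Lemma Cinf_smooth (f : Cinf) : smooth f.
Proof. by have := Cinf_subproof f; rewrite inE. Qed.

Definition mkCinf (f : M -> R) (sf : smooth f) : Cinf := MkCinf (mem_set sf).

End SmoothFunctions.

Section TangentSpaces.
Context {R : realType} {n : nat} (M : smooth_manifold R n) (p : M).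

Definition derivation_at : {pred Cinf M -> R} :=
  mem [set v : Cinf M -> R |
    scalar v /\ forall f g, v (f * g) = f p * v g + g p * v f].

Record tangent := MkTangent {
  tangent_fun :> Cinf M -> R;
  tangent_subproof : tangent_fun \in derivation_at }.

HB.instance Definition _ := [isSub for tangent_fun].
HB.instance Definition _ := [Choice of tangent by <:].

Lemma derivation_at_closed : subsemimod_closed derivation_at.
Proof.
split; first split=> [|u v].
- rewrite inE; split=> [a f g|f g] /=.
    by rewrite mulr0 addr0.
  by rewrite !mulr0 addr0.
- rewrite !inE => -[lu du] [lv dv]; split=> [a f g|f g]; rewrite addrfctE.
    by rewrite lu lv mulrDr addrACA.
  by rewrite du dv !mulrDr addrACA.
- move=> a u; rewrite !inE => -[lu du]; split=> [b f g|f g]; rewrite scalrfctE.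
    by rewrite lu scalerDr -scalerAr.
  by rewrite du scalerDr -!scalerAr.
Qed.

HB.instance Definition _ :=
  GRing.SubChoice_isSubLmodule.Build R (Cinf M -> R) derivation_at tangent
    derivation_at_closed.

Definition cotangent_pred : {pred tangent -> R} :=
  mem [set a : tangent -> R | scalar a].

Record cotangent := MkCotangent {
  cotangent_fun :> tangent -> R;
  cotangent_subproof : cotangent_fun \in cotangent_pred }.

HB.instance Definition _ := [isSub for cotangent_fun].
HB.instance Definition _ := [Choice of cotangent by <:].

Lemma cotangent_closed : subsemimod_closed cotangent_pred.
Proof.
split; first split=> [|u v].
- by rewrite inE => a f g /=; rewrite mulr0 addr0.
- rewrite !inE => lu lv a f g; rewrite addrfctE.
  by rewrite lu lv mulrDr addrACA.
- move=> a u; rewrite !inE => lu b f g; rewrite scalrfctE.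
  by rewrite lu scalerDr -scalerAr.
Qed.

HB.instance Definition _ :=
  GRing.SubChoice_isSubLmodule.Build R (tangent -> R) cotangent_pred cotangent
    cotangent_closed.

Lemma diff_at_subproof (f : Cinf M) :
  (fun v : tangent => v f) \in cotangent_pred.
Proof. by rewrite inE => a u v. Qed.

Definition diff_at (f : Cinf M) : cotangent := MkCotangent (diff_at_subproof f).

End TangentSpaces.

Section TensorFields.
Context {R : realType} {n : nat} (M : smooth_manifold R n).

Record vfield := VField {
  vfield_fun :> forall p : M, tangent p;
  vfield_smooth : forall f : Cinf M, smooth (fun p => vfield_fun p f) }.

Definition lie_deriv (X : vfield) (f : Cinf M) : Cinf M :=
  mkCinf (vfield_smooth X f).

Lemma vfieldP (X Y : vfield) :
  (forall p (f : Cinf M), X p f = Y p f) -> X = Y.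
Proof.
case: X Y => [X sX] [Y sY] /= XY.
have {}XY : X = Y.
  apply: functional_extensionality_dep => p; apply: val_inj.
  by apply: funext => f; exact: XY.
by rewrite XY in sX *; congr VField; exact: Prop_irrelevance.
Qed.

HB.instance Definition _ := gen_eqMixin vfield.
HB.instance Definition _ := gen_choiceMixin vfield.

Definition vfield0 : vfield.
Proof. by exists (fun p => 0) => f; exact: smooth_cst. Defined.

Definition vfield_opp (X : vfield) : vfield.
Proof.
exists (fun p => - X p) => f.
exact: (Cinf_smooth (- lie_deriv X f)).
Defined.

Definition vfield_add (X Y : vfield) : vfield.
Proof.
exists (fun p => X p + Y p) => f.
exact: smoothD (vfield_smooth X f) (vfield_smooth Y f).
Defined.

Definition vfield_scale (g : Cinf M) (X : vfield) : vfield.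
Proof.
exists (fun p => g p *: X p) => f.
exact: smoothM (Cinf_smooth g) (vfield_smooth X f).
Defined.

Fact vfield_addA : associative vfield_add.
Proof. by move=> X Y Z; apply: vfieldP => p f; rewrite /= addrA. Qed.

Fact vfield_addC : commutative vfield_add.
Proof. by move=> X Y; apply: vfieldP => p f; rewrite /= addrC. Qed.

Fact vfield_add0 : left_id vfield0 vfield_add.
Proof. by move=> X; apply: vfieldP => p f; rewrite /= add0r. Qed.

Fact vfield_addN : left_inverse vfield0 vfield_opp vfield_add.
Proof. by move=> X; apply: vfieldP => p f; rewrite /= addNr. Qed.

HB.instance Definition _ :=
  GRing.isZmodule.Build vfield vfield_addA vfield_addC vfield_add0 vfield_addN.

Fact vfield_scaleA g h X :
  vfield_scale g (vfield_scale h X) = vfield_scale (g * h) X.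
Proof. by apply: vfieldP => p f; rewrite /= scalerA. Qed.

Fact vfield_scale1 : left_id 1 vfield_scale.
Proof. by move=> X; apply: vfieldP => p f; rewrite /= scale1r. Qed.

Fact vfield_scaleDr : right_distributive vfield_scale +%R.
Proof. by move=> g X Y; apply: vfieldP => p f; rewrite /= scalerDr. Qed.

Fact vfield_scaleDl X : {morph vfield_scale^~ X : g h / g + h}.
Proof. by move=> g h; apply: vfieldP => p f; rewrite /= scalerDl. Qed.

HB.instance Definition _ := GRing.Zmodule_isLmodule.Build (Cinf M) vfield
  vfield_scaleA vfield_scale1 vfield_scaleDr vfield_scaleDl.

Lemma tangent_scalar (p : M) (v : tangent p) : scalar v.
Proof. by have := tangent_subproof v; rewrite inE => -[]. Qed.

Lemma tangent_leibniz (p : M) (v : tangent p) (f g : Cinf M) :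
  v (f * g) = f p * v g + g p * v f.
Proof. by have := tangent_subproof v; rewrite inE => -[]. Qed.

Lemma lie_deriv_linear X a f g :
  lie_deriv X (a *: f + g) = a *: lie_deriv X f + lie_deriv X g.
Proof.
apply: val_inj; apply: funext => p /=.
by rewrite tangent_scalar addrfctE scalrfctE.
Qed.

Lemma lie_deriv_leibniz X f g :
  lie_deriv X (f * g) = f * lie_deriv X g + g * lie_deriv X f.
Proof.
apply: val_inj; apply: funext => p /=.
by rewrite tangent_leibniz addrfctE !mulrfctE.
Qed.

Fact lie_subproof (X Y : vfield) (p : M) :
  (fun f => X p (lie_deriv Y f) - Y p (lie_deriv X f)) \in derivation_at p.
Proof.
rewrite inE; split=> [a f g|f g] /=.
  by rewrite !lie_deriv_linear !tangent_scalar; ring.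
rewrite !lie_deriv_leibniz.
have addv (v : tangent p) (h k : Cinf M) : v (h + k) = v h + v k.
  by rewrite -[h]scale1r tangent_scalar scale1r mul1r.
by rewrite !addv !tangent_leibniz /=; ring.
Qed.

Definition lie (X Y : vfield) : vfield.
Proof.
exists (fun p => MkTangent (lie_subproof X Y p)) => f.
exact: smoothB (vfield_smooth X (lie_deriv Y f)) (vfield_smooth Y (lie_deriv X f)).
Defined.

Record oneform := OneForm {
  oneform_fun :> forall p : M, cotangent p;
  oneform_smooth : forall X : vfield, smooth (fun p => oneform_fun p (X p)) }.

Definition differential (f : Cinf M) : oneform :=
  @OneForm (fun p => diff_at p f) (fun X => vfield_smooth X f).

(* Smoothness of sections of TM, T^*M and Sym^2 TM is expressed by pairing them
   with smooth functions, vector fields and 1-forms respectively.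
   Sym^2 T_p M is identified with the symmetric bilinear forms on T_p^* M. *)
Record sym_bivector := SymBivector {
  bivector_fun :> forall p : M, cotangent p -> cotangent p -> R;
  bivector_linear : forall p (a : cotangent p), scalar (bivector_fun a);
  bivector_sym : forall p (a b : cotangent p),
    bivector_fun a b = bivector_fun b a;
  bivector_smooth : forall a b : oneform,
    smooth (fun p => bivector_fun (a p) (b p)) }.

Fact sharp_subproof (theta : sym_bivector) (p : M) (a : cotangent p) :
  (fun f => theta p a (diff_at p f)) \in derivation_at p.
Proof.
rewrite inE; split=> [c f g|f g] /=.
  rewrite -bivector_linear; congr (theta p a _); apply: val_inj; apply: funext => v /=.
  by rewrite tangent_scalar addrfctE scalrfctE.
have -> : diff_at p (f * g) = f p *: diff_at p g + g p *: diff_at p f.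
  apply: val_inj; apply: funext => v /=.
  by rewrite tangent_leibniz addrfctE !scalrfctE.
have theta0 : theta p a 0 = 0.
  by have := bivector_linear theta a (-1) 0 0; rewrite scaler0 addr0 mulN1r addNr.
by rewrite bivector_linear -[g p *: _]addr0 bivector_linear theta0 addr0.
Qed.

(* The tangent vector theta(a) determined by b(theta(a)) = theta(a, b): as
   df(v) = v f, the case b = df reads theta(a) f = theta(a, df). *)
Definition sharp_at (theta : sym_bivector) (p : M) (a : cotangent p) :
  tangent p := MkTangent (sharp_subproof theta a).

Definition sharp (theta : sym_bivector) (a : oneform) : vfield :=
  @VField (fun p => sharp_at theta (a p))
    (fun f => bivector_smooth theta a (differential f)).

Definition poisson_bracket (theta : sym_bivector) (f h : Cinf M) : Cinf M :=
  mkCinf (bivector_smooth theta (differential f) (differential h)).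

Definition gradient (theta : sym_bivector) (f : Cinf M) : vfield :=
  sharp theta (differential f).

(* Additivity and the Leibniz rule for constant f give R-linearity in the second
   argument. *)
Record affine_connection := AffineConnection {
  nabla :> vfield -> vfield -> vfield;
  nabla_linearl : forall Y, linear (nabla^~ Y);
  nablaDr : forall X, {morph nabla X : Y Z / Y + Z};
  nabla_leibniz : forall X (f : Cinf M) Y,
    nabla X (f *: Y) = f *: nabla X Y + lie_deriv X f *: Y }.

Definition torsion_free (nabla : affine_connection) : Prop :=
  forall X Y, nabla X Y - nabla Y X = lie X Y.

Definition sym_bracket (nabla : affine_connection) (X Y : vfield) : vfield :=
  nabla X Y + nabla Y X.

Definition strong_sym_poisson (theta : sym_bivector)
    (nabla : affine_connection) : Prop :=
  forall f h : Cinf M, gradient theta (poisson_bracket theta f h) =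
    sym_bracket nabla (gradient theta f) (gradient theta h).

Definition char_module (theta : sym_bivector) : set vfield :=
  [set X | exists a : oneform, X = sharp theta a].

Definition is_involutive (F : set vfield) : Prop :=
  forall X Y, F X -> F Y -> F (lie X Y).

End TensorFields.

Arguments torsion_free {R n M} nabla.

(* Main.v *)
From HB Require Import structures.
From mathcomp Require Import all_boot all_order all_algebra.
From mathcomp Require Import all_classical all_analysis.
From mathcomp Require Import ring lra.
From mathcomp Require Import reals.
Require Import Defs.

(** Write [X_f] for the gradient of [f].  Evaluating the strong condition on a
    third function and using that the torsion vanishes gives a Koszul formula,
    whence [(nabla_X_f X_g) h + (nabla_X_f X_h) g = X_f {g, h}], which says that
    [theta] is parallel along its own characteristic directions.  Both sides
    are tensorial after replacing exact forms by arbitrary ones, so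
    [nabla_X theta(b) = theta(nabla_X b)] for [X = theta(a)], and since the
    torsion vanishes, [[theta(a), theta(b)]] is the image of
    [nabla_theta(a) b - nabla_theta(b) a].

    Tensoriality rests on global functions and fields with
    [rho v = sum_i v(h_i) F_i] for all tangent vectors [v] and [rho(p) = 1];
    these come from a bump function and Hadamard's lemma, as tangent vectors
    are derivations of the algebra of global smooth functions. *)

Set Implicit Arguments.
Unset Strict Implicit.
Unset Printing Implicit Defensive.

Import Order.TTheory GRing.Theory Num.Theory.
Import numFieldNormedType.Exports.

Local Open Scope classical_set_scope.
Local Open Scope ring_scope.

(** * Differentiability and the chain rule *)

Section Differentiability.
Context {R : realType}.

Lemma continuous_sumr {T : topologicalType} n (F : 'I_n -> T -> R) (x : T) :
  (forall i, {for x, continuous (F i)}) ->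
  {for x, continuous (fun y => \sum_i F i y)}.
Proof.
by move=> Fc; apply: cvg_big => [|i _]; [exact: add_continuous|exact: Fc].
Qed.

Lemma derivable_lineP {V : normedModType R} (f : V -> R) (y e : V) (s : R) :
  derivable f (y + s *: e) e ->
  is_derive s (1 : R) (fun s => f (y + s *: e)) ('D_e f (y + s *: e)).
Proof.
move=> df.
have E : (fun h : R => h^-1 *: (((fun s => f (y + s *: e)) \o shift s)
      (h *: (1 : R)) - f (y + s *: e))) =
    (fun h => h^-1 *: ((f \o shift (y + s *: e)) (h *: e) - f (y + s *: e))).
  apply/funext => h /=.
  by rewrite [_ *: 1]mulr1 scalerDl addrCA.
by apply: DeriveDef; [rewrite /derivable E|rewrite /derive E].
Qed.

(** The bound on [|s|] covers increments [c] of either sign, as needed for the coordinates of an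
    arbitrary displacement; the two signs are treated separately because the mean value theorem
    lives on an ordered segment. *)
Lemma MVT_line {V : normedModType R} (f : V -> R) (y e : V) (c : R) :
  (forall s, `|s| <= `|c| -> derivable f (y + s *: e) e) ->
  exists2 s, `|s| <= `|c| & f (y + c *: e) - f y = c * 'D_e f (y + s *: e).
Proof.
move=> df.
have dl s : `|s| <= `|c| ->
    is_derive s (1 : R) (fun s => f (y + s *: e)) ('D_e f (y + s *: e)).
  by move=> /df/derivable_lineP.
have cl (i : interval R) : (forall s, s \in i -> `|s| <= `|c|) ->
    {within [set` i], continuous (fun s => f (y + s *: e))}.
  move=> ic; apply: derivable_within_continuous => s /ic sc.
  exact: (@ex_derive _ _ _ _ _ _ _ (dl s sc)).
have [c0|c0] := leP 0 c.
  have sc s : s \in `[0, c]%R -> `|s| <= `|c|.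
    by rewrite in_itv /= => /andP[s0 sc]; rewrite !ger0_norm.
  have [s sI] := MVT_segment c0
    (fun s sI => dl s (sc s (subset_itv_oo_cc sI))) (cl _ sc).
  rewrite scale0r addr0 subr0 mulrC => E.
  by exists s => //; exact: sc.
have sc s : s \in `[c, 0]%R -> `|s| <= `|c|.
  by rewrite in_itv /= => /andP[s0 s1]; rewrite !ler0_norm ?lerN2 // ltW.
have [s sI] := MVT_segment (ltW c0)
  (fun s sI => dl s (sc s (subset_itv_oo_cc sI))) (cl _ sc).
rewrite scale0r addr0 sub0r => E.
by exists s; [exact: sc|rewrite -opprB E; ring].
Qed.

Context {n : nat}.
Implicit Types (U : set 'rV[R]_n) (f g : 'rV[R]_n -> R).

Lemma continuous_coord i : continuous (fun x : 'rV[R]_n => x 0 i).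
Proof. exact: matrix_normedtype.coord_continuous. Qed.

Lemma normr_coord (x : 'rV[R]_n) i : `|x 0 i| <= `|x|.
Proof.
rewrite [leRHS]/Num.Def.normr/= mx_normrE.
exact: (le_bigmax _ _ (0, i)).
Qed.

Lemma normr_row_le (x : 'rV[R]_n) e : 0 <= e -> (forall i, `|x 0 i| <= e) ->
  `|x| <= e.
Proof.
move=> e0 xe; rewrite [leLHS]/Num.Def.normr/= mx_normrE.
by apply: bigmax_le => // -[i j] _ /=; rewrite ord1.
Qed.

(** The displacement is made one coordinate at a time. The mean value theorem turns each move into a
    partial derivative at a nearby point, and continuity at [x] compares it with the partial
    derivative at [x]. *)
Lemma derivable_partials_differentiable f (x : 'rV[R]_n) :
  (\forall y \near x, forall i, derivable f y 'e_i) ->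
  (forall i, {for x, continuous (fun y => 'D_'e_i f y)}) ->
  differentiable f x.
Proof.
move=> df dfc.
pose L (h : 'rV[R]_n) : R := \sum_i h 0 i * 'D_'e_i f x.
have Llin : linear L.
  move=> a u v; rewrite /L scaler_sumr -big_split /=; apply: eq_bigr => i _.
  by rewrite !mxE mulrDl -mulrA.
have Lc : continuous L.
  move=> h; apply: continuous_sumr => i.
  by apply: continuousM; [exact: continuous_coord|exact: cst_continuous].
pose LL := GRing.isLinear.Build _ _ _ _ _ Llin.
pose Lm : {linear 'rV[R]_n -> R} := HB.pack L LL.
have fL : f \o shift x = cst (f x) + Lm +o_ (0 : 'rV[R]_n) id.
  apply/eqaddoP => _/posnumP[e].
  (* Each of the [n] coordinate moves may contribute this share of the error; [n.+1] also covers
     [n = 0]. *)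
  have e1 : 0 < e%:num / n.+1%:R :> R by rewrite divr_gt0.
  have H : \forall y \near x, forall i,
      derivable f y 'e_i /\ `|'D_'e_i f x - 'D_'e_i f y| <= e%:num / n.+1%:R.
    near=> y => i; split; first by move: i; near: y.
    move: i; near: y; apply: filter_forall => i.
    by have /cvgrPdist_le := dfc i; apply.
  have [/= d d0 dH] := (nbhs_ballP _ _).1 H.
  have hd0 : \forall h \near (0 : 'rV[R]_n), `|h| < d :=
    pseudometric_normed_Zmodule.nbhs0_lt d0.
  near=> h.
  have hd : `|h| < d by near: h; exact: hd0.
  (* Staircase from [0] to [h]: [hk k] keeps the first [k] coordinates of [h]. In the sup norm all
     its steps stay within [|h|], see [hks]. *)
  pose hk k : 'rV[R]_n := \row_j (if (j < k)%N then h 0 j else 0).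
  have hkn : hk n = h by apply/rowP => j; rewrite mxE ltn_ord.
  have hk0 : hk 0%N = 0 by apply/rowP => j; rewrite !mxE ltn0.
  have step (i : 'I_n) : hk i.+1 = hk i + h 0 i *: 'e_i.
    apply/rowP => j; rewrite !mxE eqxx /= ltnS leq_eqVlt.
    have [->|ji] := eqVneq j i; first by rewrite eqxx ltnn /= add0r mulr1.
    by rewrite (negbTE (_ : val j != val i)) //= mulr0 addr0.
  have hks (i : 'I_n) s : `|s| <= `|h 0 i| -> `|hk i + s *: 'e_i| <= `|h|.
    move=> sh; apply: normr_row_le => // j; rewrite !mxE eqxx /=.
    have [->|ji] := eqVneq j i; last first.
      rewrite mulr0 addr0; case: ifP => _; last by rewrite normr0.
      exact: normr_coord.
    by rewrite ltnn add0r mulr1 (le_trans sh) // normr_coord.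
  have tele : f (h + x) - f x = \sum_(i < n) (f (x + hk i.+1) - f (x + hk i)).
    rewrite -(big_mkord xpredT (fun k => f (x + hk k.+1) - f (x + hk k))).
    by rewrite telescope_sumr // hkn hk0 addr0 [h + x]addrC.
  rewrite /= opprD addrA [X in `|X - _|]tele -sumrB.
  apply: (le_trans (ler_norm_sum _ _ _)).
  apply: (@le_trans _ _ (\sum_(i < n) (e%:num / n.+1%:R * `|h|))).
    apply: ler_sum => i _; rewrite step addrA.
    have near_x s : `|s| <= `|h 0 i| -> ball x d (x + hk i + s *: 'e_i).
      move=> sh; rewrite -ball_normE /ball_ /= -addrA opprD addrA subrr add0r.
      by rewrite normrN (le_lt_trans (hks _ _ sh)).
    have [s sh ->] := @MVT_line _ f (x + hk i) 'e_i (h 0 i)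
      (fun s sh => (dH _ (near_x s sh) i).1).
    rewrite -mulrBr normrM mulrC ler_pM //; last exact: normr_coord.
    by rewrite distrC; exact: (dH _ (near_x s sh) i).2.
  rewrite sumr_const card_ord -[leLHS]mulr_natr mulrAC ler_wpM2r //.
  by rewrite -mulrA ger_pMr // mulrC ler_pdivrMr // mul1r ler_nat.
have dL := @diff_unique R 'rV[R]_n R f Lm x Lc fL.
apply/diff_locallyxP; rewrite dL; split=> // h.
by have := congr1 (fun F => F h) fL; rewrite /=.
Unshelve. all: by end_near. Qed.

End Differentiability.

Section CkCalculus.
Context {R : realType}.

Lemma CkS {n} k (U W : set 'rV[R]_n) f : W `<=` U -> Ck k U f -> Ck k W f.
Proof.
move=> WU; elim: k f => [|k IH] f [fc fd]; (split; first by move=> x /WU/fc) => //.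
move=> i; have [d1 d2] := fd i; split; first by move=> x /WU/d1.
exact: IH.
Qed.

(** [Ck] is a conjunction of pointwise conditions on the total function [f] and its derivatives, so
    it can be checked on any cover of [U]. *)
Lemma Ck_local {n} k (U : set 'rV[R]_n) f :
  (forall x, U x -> exists2 W, W x & Ck k W f) -> Ck k U f.
Proof.
elim: k f => [|k IH] f H.
  by split=> // x /H[W Wx [fc _]]; exact: fc.
split; first by move=> x /H[W Wx [fc _]]; exact: fc.
move=> i; split; first by move=> x /H[W Wx [_ /(_ i) [d _]]]; exact: d.
by apply: IH => x /H[W Wx [_ /(_ i) [_ d]]]; exists W.
Qed.

Lemma is_derive_coord {n} (x : 'rV[R]_n) i j :
  is_derive x ('e_j : 'rV[R]_n) (fun x : 'rV[R]_n => x 0 i : R) (i == j)%:R.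
Proof.
have E : (fun h : R => h^-1 *:
      (((fun x : 'rV[R]_n => x 0 i) \o shift x) (h *: 'e_j) - x 0 i)) =
    (fun h : R => h^-1 * (h * (i == j)%:R)).
  by apply/funext => h /=; rewrite !mxE eqxx /= addrK.
have cv : (fun h : R => h^-1 * (h * (i == j)%:R)) @ 0^' --> ((i == j)%:R : R).
  apply: cvg_near_cst; near=> h.
  rewrite mulKf //; near: h; exact: nbhs_dnbhs_neq.
apply: DeriveDef; first by apply/cvg_ex; exists (i == j)%:R; rewrite E.
by rewrite /derive E; apply/cvg_lim.
Unshelve. all: by end_near. Qed.

Lemma derive_coord {n} (x : 'rV[R]_n) i j :
  'D_'e_j (fun x : 'rV[R]_n => x 0 i : R) x = (i == j)%:R.
Proof. exact: (@derive_val _ _ _ _ _ _ _ (is_derive_coord x i j)). Qed.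

Lemma Ck_coord {n} k (U : set 'rV[R]_n) i : Ck k U (fun x => x 0 i).
Proof.
case: k => [|k]; (split; first by move=> x _; exact: continuous_coord) => //.
move=> j; split=> [x _|].
  exact: (@ex_derive _ _ _ _ _ _ _ (is_derive_coord x i j)).
suff -> : (fun x : 'rV[R]_n => 'D_'e_j (fun x : 'rV[R]_n => x 0 i : R) x) =
    fun=> (i == j)%:R by exact: Ck_cst.
by apply/funext => x; exact: derive_coord.
Qed.

Lemma Ck_differentiable {n} k (U : set 'rV[R]_n) f x :
  open U -> Ck k.+1 U f -> U x -> differentiable f x.
Proof.
move=> oU [fc fd] Ux; apply: derivable_partials_differentiable.
  by apply: filterS (open_nbhs_nbhs (conj oU Ux)) => y Uy i; exact: (fd i).1.
move=> i; case: k fd => [|k] fd; exact: (fd i).2.1.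
Qed.

Lemma derive_partials {n} (f : 'rV[R]_n -> R) x v : differentiable f x ->
  'D_v f x = \sum_i v 0 i * 'D_'e_i f x.
Proof.
move=> df; rewrite deriveE // [in LHS](row_sum_delta v) linear_sum.
by apply: eq_bigr => i _; rewrite linearZ deriveE.
Qed.

Lemma deriveE_line {V W : normedModType R} (f : V -> W) x v :
  'D_v f x = 'D_1 (fun h : R => f (h *: v + x)) 0.
Proof.
rewrite /derive; set F := (X in lim (X @ _)); set F' := (X in _ = lim (X @ _)).
suff -> : F = F' by [].
by apply/funext => h; rewrite /F /F' /= addr0 scale0r add0r [_ *: 1]mulr1.
Qed.

(** [G] is only derivable along [v], so it is restricted to the line [h *: v + x]: for a curve,
    derivability and differentiability agree, and the chain rule for differentials applies. *)
Lemma is_derive_comp_row {n} {V : normedModType R} (f : 'rV[R]_n -> R)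
    (G : V -> 'rV[R]_n) x v :
  differentiable f (G x) -> (forall j, derivable (fun y => G y 0 j) x v) ->
  is_derive x v (f \o G)
    (\sum_j 'D_'e_j f (G x) * 'D_v (fun y => G y 0 j) x).
Proof.
move=> df dG.
have dG1 : derivable G x v by apply/derivable_mxP => i j; rewrite ord1; exact: dG.
pose g (h : R) := G (h *: v + x).
have g0 : g 0 = G x by rewrite /g scale0r add0r.
have dg : differentiable g 0.
  by apply/derivable1_diffP; exact: (derivable1P _ _ _).1 dG1.
have dfg : differentiable (f \o g) 0.
  by apply: differentiable_comp => //; rewrite g0.
have dfG : derivable (f \o G) x v.
  apply: (derivable1P _ _ _).2; exact: (derivable1_diffP _ _).2 dfg.
apply: DeriveDef => //.
have -> : 'D_v (f \o G) x = 'D_1 (f \o g) 0 by exact: deriveE_line.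
rewrite deriveE // diff_comp //; last by rewrite g0.
have dgE : 'd g 0 1 = 'D_v G x by rewrite -deriveE // [RHS]deriveE_line.
rewrite /= dgE g0 -deriveE // derive_partials //.
by apply: eq_bigr => j _; rewrite derive_mx // mxE mulrC.
Qed.

Lemma Ck_sum {n} k (U : set 'rV[R]_n) m (F : 'I_m -> 'rV[R]_n -> R) :
  open U -> (forall j, Ck k U (F j)) -> Ck k U (fun x => \sum_j F j x).
Proof.
move=> oU HF.
suff -> : (fun x => \sum_j F j x) = \sum_j F j.
  apply: big_ind => [|f g Hf Hg|j _]; [exact: Ck_cst|exact: CkD|exact: HF].
by apply/funext => x; rewrite fct_sumE.
Qed.

(** By induction on [k]: each partial derivative of the composite is a sum of products of
    ['D_'e_j f \o G] with a partial derivative of a component of [G], all of one order less. *)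
Lemma Ck_comp {n m} k (U : set 'rV[R]_n) (V : set 'rV[R]_m)
    (f : 'rV[R]_m -> R) (G : 'rV[R]_n -> 'rV[R]_m) :
  open U -> open V -> (forall x, U x -> V (G x)) ->
  Ck k V f -> (forall j, Ck k U (fun x => G x 0 j)) -> Ck k U (f \o G).
Proof.
move=> oU oV UV.
have cG x : (forall j x, U x -> {for x, continuous (fun x => G x 0 j)}) ->
    U x -> {for x, continuous G}.
  move=> Hc Ux; apply/(@cvgrPdist_le _ _ _ (nbhs x) _ G (G x)) => e e0; near=> y.
  apply: normr_row_le; first exact: ltW.
  move=> i; rewrite !mxE; move: i; near: y; apply: filter_forall => i.
  by have /cvgrPdist_le := Hc i x Ux; apply.
elim: k f => [|k IH] f Hf HG.
  split=> // x Ux; apply: continuous_comp; last exact: (Hf.1 _ (UV _ Ux)).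
  by apply: cG => // j; exact: (HG j).1.
have cfG x : U x -> {for x, continuous (f \o G)}.
  move=> Ux; apply: continuous_comp; last exact: (Hf.1 _ (UV _ Ux)).
  by apply: cG => // j; exact: (HG j).1.
have dfG i x : U x -> is_derive x 'e_i (f \o G)
    (\sum_j 'D_'e_j f (G x) * 'D_'e_i (fun y => G y 0 j) x).
  move=> Ux; apply: is_derive_comp_row.
    exact: (Ck_differentiable oV Hf (UV _ Ux)).
  by move=> j; exact: ((HG j).2 i).1.
split=> // i; split=> [x Ux|].
  exact: (@ex_derive _ _ _ _ _ _ _ (dfG i x Ux)).
apply: (@eq_Ck _ _ _ _ (fun x => \sum_j
  ('D_'e_j f (G x) * 'D_'e_i (fun y => G y 0 j) x))) => //.
  by move=> x Ux; rewrite (@derive_val _ _ _ _ _ _ _ (dfG i x Ux)).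
apply: Ck_sum => // j; apply: (CkM (f := ('D_'e_j f) \o G)) => //.
  by apply: IH; [exact: (Hf.2 j).2|move=> l; exact: CkW].
exact: ((HG j).2 i).2.
Unshelve. all: by end_near. Qed.

End CkCalculus.

(** * Bump functions *)

Section FlatFunction.
Context {R : realType}.

Lemma is_derive_comp_real {V : normedModType R} (g : R -> R) (P : V -> R) x v dg :
  is_derive (P x) 1 g dg -> derivable P x v ->
  is_derive x v (g \o P) (dg * 'D_v P x).
Proof.
move=> [dgP <-] dP.
pose p (h : R) := P (h *: v + x).
have p0 : p 0 = P x by rewrite /p scale0r add0r.
have dp : derivable p 0 1 := (derivable1P _ _ _).1 dP.
have dgp : differentiable (g \o p) 0.
  have dp' : differentiable p 0 by exact/derivable1_diffP.
  apply: differentiable_comp => //; rewrite /p scale0r add0r.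
  exact/derivable1_diffP.
apply: DeriveDef.
  by apply: (derivable1P _ _ _).2; exact: (derivable1_diffP _ _).2 dgp.
rewrite deriveE_line -[fun h => _]/(g \o p) -derive1E derive1_comp ?p0 //.
by rewrite !derive1E ?p0 ['D_v P x]deriveE_line.
Qed.

(** For [k = 0] this is the standard smooth function flat at [0]. The powers of [t^-1] make the span
    of the family closed under differentiation, see [is_derive_flat]. *)
Definition flat k (t : R) : R := if 0 < t then t^-1 ^+ k * expR (- t^-1) else 0.

Lemma flat_ge0 k t : 0 <= flat k t.
Proof.
rewrite /flat; case: ltP => // t0.
by rewrite mulr_ge0 ?expR_ge0 // exprn_ge0 // invr_ge0 ltW.
Qed.

Lemma flat_gt0 k t : 0 < t -> 0 < flat k t.
Proof.
by move=> t0; rewrite /flat t0 mulr_gt0 ?expR_gt0 // exprn_gt0 // invr_gt0.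
Qed.

Lemma flat_le0 k t : t <= 0 -> flat k t = 0.
Proof. by move=> t0; rewrite /flat ltNge t0. Qed.

(** A single term of the exponential series, of degree [k.+1] at [t^-1], already dominates. The
    bound gives the limit of the difference quotient at [0]. *)
Lemma flat_bound k t : `|flat k t| <= k.+1`!%:R * `|t|.
Proof.
rewrite ger0_norm ?flat_ge0 // /flat; case: ltP => [t0|_]; last exact: mulr_ge0.
rewrite gtr0_norm // expRN.
have ft : 0 < k.+1`!%:R :> R by rewrite ltr0n fact_gt0.
have u0 : 0 < t^-1 by rewrite invr_gt0.
have : t^-1 ^+ k.+1 / k.+1`!%:R <= expR t^-1.
  by apply: le_trans (expR_ge1Dxn k (ltW u0)); rewrite lerDr.
rewrite ler_pdivrMr // => H.
rewrite ler_pdivrMr ?expR_gt0 // -(ler_pM2l u0) -exprS (le_trans H) //.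
have -> //: t^-1 * (k.+1`!%:R * t * expR t^-1) = expR t^-1 * k.+1`!%:R.
by field; rewrite lt0r_neq0.
Qed.

Lemma is_derive_flat k (t : R) :
  is_derive t (1 : R) (flat k) (- k%:R * flat k.+1 t + flat k.+2 t).
Proof.
have [t0|t0|->] := ltgtP t 0.
- apply: (@near_eq_is_derive _ _ _ (cst 0)); last first.
    by rewrite !flat_le0 ?ltW // mulr0 addr0; exact: is_derive_cst.
  near=> s; rewrite flat_le0 // ltW //; near: s; exact: lt_nbhsl.
- apply: (@near_eq_is_derive R R R (fun s : R => s^-1 ^+ k * expR (- s^-1) : R)).
    near=> s; rewrite /flat ifT //; near: s; exact: lt_nbhsr.
  have tn : t != 0 by rewrite lt0r_neq0.
  have dV : is_derive t 1 (fun s : R => s^-1) (- t ^- 2).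
    apply: is_derive_eq; first exact: (@is_deriveV _ id).
    by rewrite /= [_ *: 1]mulr1.
  have dE := @is_derive1_comp R expR (- (fun s : R => s^-1)) t _ _
    (is_derive_expR _) (is_deriveN dV).
  have dM := is_deriveM (is_deriveX k dV) dE.
  have -> : (fun s : R => s^-1 ^+ k * expR (- s^-1)) =
      (fun s : R => s^-1) ^+ k * (expR \o (- (fun s : R => s^-1))).
    by apply/funext => s; rewrite exprfctE.
  apply: is_derive_eq; rewrite /flat t0 exprfctE /= ![_ *: _]mulrC.
  rewrite /GRing.scale /= -exprVn !exprS; case: k {dM} => [|k]; first by ring.
  by rewrite /= [(- _) t](_ : _ = - t^-1) // exprS expr0; ring.
- rewrite !flat_le0 // mulr0 addr0.
  have cv : (fun h : R => h^-1 *: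
      ((flat k \o shift 0) (h *: 1) - flat k 0)) @ 0^' --> (0 : R).
    (* At [0] the difference quotient of [flat k] is [flat k.+1] itself, which tends to [0] by
       [flat_bound]. *)
    have -> : (fun h : R => h^-1 *:
        ((flat k \o shift 0) (h *: 1) - flat k 0)) = flat k.+1.
      apply/funext => h /=; rewrite addr0 [_ *: 1]mulr1 (@flat_le0 k 0) // subr0.
      by rewrite /flat; case: ifP => _; rewrite ?scaler0 // exprS -mulrA.
    apply: cvg_within_filter; apply/cvgrPdist_le => e e0.
    have e1 : 0 < e / k.+2`!%:R by rewrite divr_gt0 // ltr0n fact_gt0.
    have he := @pseudometric_normed_Zmodule.nbhs0_le _ R _ e1.
    near=> h.
    rewrite sub0r normrN (le_trans (flat_bound _ _)) //.
    rewrite mulrC -ler_pdivlMr ?ltr0n ?fact_gt0 //.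
  by apply: DeriveDef; [apply/cvg_ex; exists 0|exact/cvg_lim].
Unshelve. all: by end_near. Qed.

Lemma continuous_flat k : continuous (flat k).
Proof.
move=> t; apply/differentiable_continuous/derivable1_diffP.
exact: (@ex_derive _ _ _ _ _ _ _ (is_derive_flat k t)).
Qed.

(** The induction on [m] is over all [k] at once, since differentiating [flat k] brings in
    [flat k.+1] and [flat k.+2]. *)
Lemma Ck_flat_comp {n} m (U : set 'rV[R]_n) P k :
  open U -> smooth_on U P -> Ck m U (flat k \o P).
Proof.
move=> oU sP.
have cP j x : U x -> {for x, continuous (flat j \o P)}.
  move=> Ux; apply: continuous_comp; last exact: continuous_flat.
  exact: (sP 0%N).1.
elim: m k => [|m IH] k; (split; first by move=> x; exact: cP) => //.
move=> i.
have dP x : U x -> is_derive x 'e_i (flat k \o P)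
    ((- k%:R * flat k.+1 (P x) + flat k.+2 (P x)) * 'D_'e_i P x).
  move=> Ux; apply: is_derive_comp_real; first exact: is_derive_flat.
  exact: ((sP 1%N).2 i).1.
split=> [x Ux|]; first exact: (@ex_derive _ _ _ _ _ _ _ (dP x Ux)).
apply: (@eq_Ck _ _ _ _
  ((cst (- k%:R) * (flat k.+1 \o P) + (flat k.+2 \o P)) * 'D_'e_i P)) => //.
  by move=> x Ux; rewrite (@derive_val _ _ _ _ _ _ _ (dP x Ux)).
apply: CkM => //; last exact: ((sP m.+1).2 i).2.
by apply: CkD => //; apply: CkM => //; exact: Ck_cst.
Qed.

Lemma exists_bump {n} (V : set 'rV[R]_n) x0 : open V -> V x0 ->
  exists phi K, [/\ smooth_on setT phi, phi x0 = 1, compact K, K `<=` V &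
    forall x, ~ K x -> phi x = 0].
Proof.
move=> oV Vx0; have := open_nbhs_nbhs (conj oV Vx0).
move=> /(nbhs_ballP _ _).1[r /= r0 rV].
(* The Euclidean square makes [d] a polynomial, whereas the norm on rows is the sup norm; [0 <= d x]
   still bounds the sup distance to [x0] by [r / 2]. The bump is [flat 0 \o d], normalised at
   [x0]. *)
pose d (x : 'rV[R]_n) : R := (r / 2) ^+ 2 - \sum_i (x 0 i - x0 0 i) ^+ 2.
have d0 : 0 < d x0.
  rewrite /d big1 ?subr0 ?exprn_gt0 // ?divr_gt0 // => i _.
  by rewrite subrr expr0n.
have sd : smooth_on setT d.
  move=> k; apply: (@CkD _ _ _ _ (cst ((r / 2) ^+ 2))
    (fun x : 'rV[R]_n => - (\sum_i (x 0 i - x0 0 i) ^+ 2))).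
  - exact: openT.
  - exact: Ck_cst.
  rewrite (_ : (fun _ => _) = cst (-1) *
    (fun x : 'rV[R]_n => \sum_i (x 0 i - x0 0 i) ^+ 2)); last first.
    by apply/funext => x; rewrite mulrfctE mulN1r.
  apply: CkM; [exact: openT|exact: Ck_cst|apply: Ck_sum; first exact: openT].
  move=> i; have H : Ck k setT (fun x : 'rV[R]_n => x 0 i - x0 0 i).
    by apply: (@CkD _ _ _ _ (fun x => x 0 i) (cst (- x0 0 i)));
      [exact: openT|exact: Ck_coord|exact: Ck_cst].
  exact: (CkM (openT) H H).
have dr x : 0 <= d x -> `|x - x0| <= r / 2.
  move=> dx; have r2 : 0 <= r / 2 by rewrite divr_ge0 // ltW.
  apply: normr_row_le => // i.
  rewrite -ler_sqr ?nnegrE // real_normK ?num_real // !mxE.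
  move: dx; rewrite /d subr_ge0; apply: le_trans.
  by rewrite (bigD1 i) //= lerDl sumr_ge0 // => j _; exact: sqr_ge0.
exists (cst (flat 0 (d x0))^-1 * (flat 0 \o d)), [set x | 0 <= d x]; split.
- move=> k; apply: CkM; [exact: openT|exact: Ck_cst|].
  by apply: Ck_flat_comp => //; exact: openT.
- by rewrite mulrfctE mulVf // lt0r_neq0 // flat_gt0.
- apply: bounded_closed_compact.
    exists (`|x0| + r / 2); split; first exact: num_real.
    move=> N MN x /dr xr; apply: le_trans (ltW MN).
    by rewrite -[x](subrK x0) addrC (le_trans (ler_normD _ _)) // lerD2l.
  rewrite (_ : mkset _ = d @^-1` [set t | 0 <= t]) //.
  by apply: preimage_closed; [move=> x _; exact: (sd 0%N).1|exact: closed_ge].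
- move=> x /dr xr; apply: rV; rewrite -ball_normE /ball_ /= distrC.
  by rewrite (le_lt_trans xr) // ltr_pdivrMr // mulr2n mulrDr mulr1 ltrDl.
- move=> x /negP; rewrite -ltNge => /ltW dx.
  by rewrite mulrfctE /= (@flat_le0 0 (d x)) // mulr0.
Qed.

End FlatFunction.

(** * Hadamard's lemma *)

Lemma continuous_pair {T U V : topologicalType} (f : T -> U) (g : T -> V) x :
  {for x, continuous f} -> {for x, continuous g} ->
  {for x, continuous (fun y => (f y, g y))}.
Proof.
move=> cf cg A [[B C] /= [Bf Cg] BC].
have : nbhs x (f @^-1` B `&` g @^-1` C) by apply: filterI; [exact: cf|exact: cg].
by apply: filterS => y [By Cy]; exact: (BC (f y, g y)).
Qed.

Section Hadamard.
Context {R : realType} {n : nat}.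
Implicit Types (h f : 'rV[R]_n -> R) (x : 'rV[R]_n).
Notation mu := (@lebesgue_measure R).

Definition ray_fun m h x0 x (t : R) : R := t ^+ m * h (x0 + t *: (x - x0)).

(* The weight [t ^ m] keeps this family closed under differentiation, see
   [is_derive_ray_int]. *)
Definition ray_int m h x0 x : R := \int[mu]_(t in `[0, 1]) ray_fun m h x0 x t.

Lemma continuous_ray_fun m h x0 : continuous h ->
  continuous (fun p : R * 'rV[R]_n => ray_fun m h x0 p.2 p.1).
Proof.
move=> hc p; rewrite /ray_fun.
have c1 : {for p, continuous (fun p : R * 'rV[R]_n => p.1)} by exact: cvg_fst.
have c2 : {for p, continuous (fun p : R * 'rV[R]_n => p.2)} by exact: cvg_snd.
apply: (@continuousM R (R * 'rV[R]_n)%type (fun p => p.1 ^+ m)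
    (fun p => h (x0 + p.1 *: (p.2 - x0)))).
  apply: (@continuous_comp (R * 'rV[R]_n)%type R R fst (fun t => t ^+ m)) => //.
  exact: exprn_continuous.
apply: (@continuous_comp (R * 'rV[R]_n)%type _ R
    (fun p => x0 + p.1 *: (p.2 - x0)) h);
  last exact: hc.
apply: (@continuousD R _ (R * 'rV[R]_n)%type (cst x0)).
  exact: cst_continuous.
apply: (@continuousZ R _ (R * 'rV[R]_n)%type) => //.
apply: (@continuousB R _ (R * 'rV[R]_n)%type snd (cst x0)) => //.
exact: cst_continuous.
Qed.

Lemma continuous_ray_funt m h x0 x : continuous h -> continuous (ray_fun m h x0 x).
Proof.
move=> hc t; apply: (@continuous_comp R (R * 'rV[R]_n)%type R (fun t => (t, x))
  (fun p => ray_fun m h x0 p.2 p.1)).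
  by apply: continuous_pair => //; exact: cst_continuous.
exact: continuous_ray_fun.
Qed.

Lemma integrable_continuous01 (g : R -> R) : continuous g ->
  mu.-integrable `[0, 1] (EFin \o g).
Proof.
move=> gc; apply: continuous_compact_integrable; first exact: segment_compact.
exact: continuous_subspaceT.
Qed.

(** By compactness of [[0, 1]] the integrands at [x] and at a nearby [y] are uniformly close in [t],
    hence so are the integrals. *)
Lemma continuous_ray_int m h x0 : continuous h -> continuous (ray_int m h x0).
Proof.
move=> hc x; apply/(@cvgrPdist_le _ _ _ (nbhs x) _ _ (ray_int m h x0 x)) => e e0.
have H : \forall y \near x, `[0, 1] `<=`
    [set t : R | `|ray_fun m h x0 x t - ray_fun m h x0 y t| <= e].
  have /compact_near_coveringP cov := @segment_compact R 0 1.
  apply: (cov _ (nbhs x)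
    (fun y t => `|ray_fun m h x0 x t - ray_fun m h x0 y t| <= e)) => t _.
  have e2 : 0 < e / 2 by rewrite divr_gt0.
  have /(cvgrPdist_le _ _).1 /(_ _ e2) [[A B] /= [At Bx] AB] :=
    @continuous_ray_fun m h x0 hc (t, x).
  exists (A, B) => // -[s y] /= [As By].
  have := AB (s, x) (conj As (nbhs_singleton Bx)).
  have := AB (s, y) (conj As By).
  rewrite /= => H1 H2; rewrite (splitr e).
  rewrite -(subrKA (ray_fun m h x0 x t)) (le_trans (ler_normD _ _)) //.
  by rewrite lerD // distrC.
near=> y.
have ys : `[0, 1] `<=`
    [set t : R | `|ray_fun m h x0 x t - ray_fun m h x0 y t| <= e].
  by near: y; exact: H.
have ir z : mu.-integrable `[0, 1] (EFin \o ray_fun m h x0 z).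
  by apply: integrable_continuous01; exact: continuous_ray_funt.
rewrite /ray_int -RintegralB //.
have ci : continuous (fun t => ray_fun m h x0 x t - ray_fun m h x0 y t).
  by move=> t; apply: continuousB; exact: continuous_ray_funt.
have cn : continuous (fun t => `|ray_fun m h x0 x t - ray_fun m h x0 y t|).
  by move=> t; apply: cvg_norm; exact: ci.
apply: le_trans (le_normr_Rintegral _ _) _ => //.
  exact: integrable_continuous01.
apply: (@le_trans _ _ (\int[mu]_(t in `[0, 1]) e)).
  apply: le_Rintegral => //.
  - exact: integrable_continuous01 cn.
  - apply: integrable_continuous01; exact: cst_continuous.
have -> : \int[mu]_(_ in `[0, 1]) e = e * fine (mu `[0%R, 1%R]).
  by apply: Rintegral_cst.
rewrite lebesgue_measure_itv /= lte_fin ltr01.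
by rewrite -EFinB /= subr0 mulr1.
Unshelve. all: by end_near. Qed.

Lemma is_derive_ray_fun m h x0 x t v :
  differentiable h (x0 + t *: (x - x0)) ->
  is_derive x v (fun x => ray_fun m h x0 x t)
    (ray_fun m.+1 (fun y => 'D_v h y) x0 x t).
Proof.
move=> dh; set y := x0 + t *: (x - x0).
have dhtv : derivable h y (t *: v) by exact: diff_derivable.
have E : (fun s : R => s^-1 *:
      (((fun x => h (x0 + t *: (x - x0))) \o shift x) (s *: v)
      - h (x0 + t *: (x - x0)))) =
    (fun s : R => s^-1 *: ((h \o shift y) (s *: (t *: v)) - h y)).
  apply/funext => s /=; rewrite /y; congr (_ *: (h _ - _)).
  rewrite -addrA scalerDr addrCA; congr (_ + _).
  by rewrite !scalerA mulrC.
have dg : is_derive x v (fun x => h (x0 + t *: (x - x0))) ('D_(t *: v) h y).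
  by apply: DeriveDef; [rewrite /derivable E|rewrite /derive E].
have -> : ray_fun m.+1 (fun y => 'D_v h y) x0 x t = t ^+ m *: 'D_(t *: v) h y.
  by rewrite /ray_fun -/y !deriveE // linearZ exprSr -mulrA.
exact: is_deriveZ.
Qed.

Lemma is_derive_ray_int m h x0 x j : Ck 1 setT h ->
  is_derive x 'e_j (ray_int m h x0) (ray_int m.+1 ('D_'e_j h) x0 x).
Proof.
move=> h1.
have hc : continuous h by move=> y; exact: h1.1.
have Dhc : continuous ('D_'e_j h) by move=> y; exact: (h1.2 j).2.1.
have dh y : differentiable h y by exact: (Ck_differentiable openT h1).
pose f s t := ray_fun m h x0 (x + s *: 'e_j) t.
pose w (p : R * R) : R := ray_fun m.+1 ('D_'e_j h) x0 (x + p.1 *: 'e_j) p.2.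
have df s t : is_derive (s : R) (1 : R) (f ^~ t) (w (s, t)).
  have [d1 d2] := is_derive_ray_fun m 'e_j (dh (x0 + t *: ((x + s *: 'e_j) - x0))).
  by have := derivable_lineP d1; rewrite d2.
have wc : continuous w.
  move=> p; apply: (@continuous_comp (R * R)%type (R * 'rV[R]_n)%type R
    (fun p => (p.2, x + p.1 *: 'e_j))
    (fun q => ray_fun m.+1 ('D_'e_j h) x0 q.2 q.1)).
    apply: continuous_pair; first exact: cvg_snd.
    apply: (@continuousD R _ (R * R)%type (cst x)); first exact: cst_continuous.
    apply: (@continuousZ R _ (R * R)%type); first exact: cvg_fst.
    exact: cst_continuous.
  exact: continuous_ray_fun.
(* The derivative in [s] is bounded on the compact rectangle [[-1, 1] x [0, 1]]; this constant is
   the dominating function for differentiation under the integral sign. *)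
have [C CP] : exists C, forall s t,
    `]-1, 1[%classic s -> `[0, 1]%classic t -> `|w (s, t)| <= C.
  have cK := compact_setX (@segment_compact R (-1) 1) (@segment_compact R 0 1).
  have [C [_ HC]] := compact_bounded (continuous_compact (continuous_subspaceT wc) cK).
  exists (C + 1) => s t sI tI; apply: (HC (C + 1)); first by rewrite ltrDl.
  by exists (s, t) => //; split=> //=; exact: subset_itv_oo_cc.
have mI : measurable (`[0, 1]%classic : set R) by exact: measurable_itv.
have I0 : `]-1, 1[%classic (0 : R) by rewrite /= in_itv /= ltrN10 ltr01.
have intf s : `]-1, 1[%classic s -> mu.-integrable `[0, 1] (EFin \o f s).
  by move=> _; apply: integrable_continuous01; exact: continuous_ray_funt.
have derf s t : `]-1, 1[%classic s -> `[0, 1]%classic t -> derivable (f ^~ t) s 1.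
  by move=> _ _; exact: (@ex_derive _ _ _ _ _ _ _ (df s t)).
have pf s t : partial1of2 f s t = w (s, t).
  by rewrite partial1of2E (@derive_val _ _ _ _ _ _ _ (df s t)).
have C0 : 0 <= C.
  by apply: le_trans (CP 0 0 I0 _); rewrite //= in_itv /= lexx ler01.
have ub s t : `]-1, 1[%classic s -> `[0, 1]%classic t -> `|partial1of2 f s t| <= C.
  by rewrite pf; exact: CP.
have intC : mu.-integrable `[0, 1] (EFin \o cst C).
  by apply: integrable_continuous01; exact: cst_continuous.
have dF := @derivable_under_integral R _ _ mu f `[0, 1]%classic mI 0 (-1) 1 I0
  intf derf (cst C) (fun=> C0) intC ub.
have vF := @differentiation_under_integral R _ _ mu f `[0, 1]%classic mI 0 (-1) 1 I0
  intf derf (cst C) (fun=> C0) intC ub.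
have E : (fun s : R => ray_int m h x0 (s *: 'e_j + x)) =
   (fun s => \int[mu]_(t in `[0, 1]) f s t).
  by apply/funext => s; rewrite /f [x + _]addrC.
apply: DeriveDef.
  by apply/(derivable1P _ _ _).2; rewrite E.
rewrite deriveE_line E -derive1E vF; apply: eq_Rintegral => t _.
by rewrite pf /w /= scale0r addr0.
Qed.

Lemma Ck_ray_int k m h x0 : Ck k.+1 setT h -> Ck k setT (ray_int m h x0).
Proof.
elim: k m h => [|k IH] m h hk.
  by split=> // x _; apply: continuous_ray_int => y; exact: hk.1.
have h1 : Ck 1 setT h.
  by elim: k {IH} hk => [|k IH] /CkW.
split; first by move=> x _; apply: continuous_ray_int => y; exact: hk.1.
move=> i; split.
  by move=> x _; exact: (@ex_derive _ _ _ _ _ _ _ (is_derive_ray_int m x0 x i h1)).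
apply: (@eq_Ck _ _ _ _ (ray_int m.+1 ('D_'e_i h) x0)); first exact: openT.
  by move=> x _; rewrite (@derive_val _ _ _ _ _ _ _ (is_derive_ray_int m x0 x i h1)).
by apply: IH; exact: (hk.2 i).2.
Qed.

Lemma ray_int0 h x0 : ray_int 0 h x0 x0 = h x0.
Proof.
have -> : ray_int 0 h x0 x0 = \int[mu]_(_ in `[0, 1]) h x0.
  by apply: eq_Rintegral => t _; rewrite /ray_fun expr0 mul1r subrr scaler0 addr0.
have -> : \int[mu]_(_ in `[0, 1]) h x0 = h x0 * fine (mu `[0%R, 1%R]).
  by apply: Rintegral_cst.
rewrite lebesgue_measure_itv /= lte_fin ltr01.
by rewrite -EFinB /= subr0 mulr1.
Qed.

Lemma Rintegral01_sum m (c : 'I_m -> R) (u : 'I_m -> R -> R) :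
  (forall i, continuous (u i)) ->
  \int[mu]_(t in `[0, 1]) (\sum_i c i * u i t) =
  \sum_i c i * \int[mu]_(t in `[0, 1]) u i t.
Proof.
move=> uc.
have cuc i : continuous (fun t => c i * u i t).
  by move=> t; apply: continuousM; [exact: cst_continuous|exact: uc].
have cs (s : seq 'I_m) : continuous (fun t => \sum_(i <- s) c i * u i t).
  elim: s => [|i s IH] t; last first.
    under eq_fun do rewrite big_cons.
    by apply: (@continuousD R R R (fun t => c i * u i t)); [exact: cuc|exact: IH].
  by under eq_fun do rewrite big_nil; exact: cst_continuous.
elim: index_enum => [|i s IH].
  rewrite big_nil; under eq_Rintegral do rewrite big_nil.
  by rewrite Rintegral_cst ?mul0r.
rewrite big_cons; under eq_Rintegral do rewrite big_cons.
rewrite RintegralD ?IH ?RintegralZl //; exact: integrable_continuous01.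
Qed.

(** [f x - f x0] is the integral over [[0, 1]] of the derivative of [f] along the segment from [x0]
    to [x]. Expanding that derivative in partial derivatives exhibits [g i] as the ray integral of
    ['D_'e_i f] with weight [1]. *)
Lemma hadamard f x0 : smooth_on setT f ->
  exists g : 'I_n -> 'rV[R]_n -> R, [/\ forall i, smooth_on setT (g i),
    forall i, g i x0 = 'D_'e_i f x0 &
    forall x, f x = f x0 + \sum_i (x 0 i - x0 0 i) * g i x].
Proof.
move=> sf; exists (fun i => ray_int 0 ('D_'e_i f) x0); split.
- by move=> i k; apply: Ck_ray_int; exact: ((sf k.+2).2 i).2.
- by move=> i; rewrite ray_int0.
move=> x; apply/eqP; rewrite addrC -subr_eq; apply/eqP.
have df y : differentiable f y by exact: (Ck_differentiable openT (sf 1%N)).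
have Dc i : continuous ('D_'e_i f) by move=> y; exact: ((sf 1%N).2 i).2.1.
pose F t := f (x0 + t *: (x - x0)).
pose g t := \sum_i (x 0 i - x0 0 i) * ray_fun 0 ('D_'e_i f) x0 x t.
have dF t : is_derive (t : R) (1 : R) F (g t).
  have := derivable_lineP (diff_derivable (v := x - x0) (df (x0 + t *: (x - x0)))).
  rewrite derive_partials // (_ : \sum_i _ = g t) //.
  by apply: eq_bigr => i _; rewrite !mxE /ray_fun expr0 mul1r.
have gc : continuous g.
  move=> t; apply: continuous_sumr => i; apply: continuousM; first exact: cst_continuous.
  exact: continuous_ray_funt.
have Fc t : {for t, continuous F}.
  apply/differentiable_continuous/derivable1_diffP.
  exact: (@ex_derive _ _ _ _ _ _ _ (dF t)).
have oo : derivable_oo_LRcontinuous F 0 1.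
  split=> [t _||].
  - exact: (@ex_derive _ _ _ _ _ _ _ (dF t)).
  - by apply: cvg_at_right_filter; exact: Fc.
  - by apply: cvg_at_left_filter; exact: Fc.
have F'g : {in `]0, 1[, F^`()%classic =1 g}.
  by move=> t _; rewrite derive1E (@derive_val _ _ _ _ _ _ _ (dF t)).
have := @continuous_FTC2 R g F 0 1 ltr01 (continuous_subspaceT gc) oo F'g.
move=> /(congr1 fine).
have -> : F 1 = f x by rewrite /F scale1r addrC subrK.
have -> : F 0 = f x0 by rewrite /F scale0r addr0.
rewrite -EFinB /= => <-; rewrite -[LHS]/(\int[mu]_(t in `[0, 1]) g t).
apply: Rintegral01_sum => i; exact: continuous_ray_funt.
Qed.

End Hadamard.

(** * Functions and vector fields supported in a chart *)

Section Manifold.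
Context {R : realType} {n : nat} {M : smooth_manifold R n}.
Implicit Types (c d : chart R n M) (f g : Cinf M) (q : M).

Lemma CinfDE f g q : (f + g) q = f q + g q. Proof. by []. Qed.
Lemma CinfNE f q : (- f) q = - f q. Proof. by []. Qed.
Lemma CinfBE f g q : (f - g) q = f q - g q. Proof. by []. Qed.
Lemma CinfME f g q : (f * g) q = f q * g q. Proof. by []. Qed.
Lemma CinfZE a f q : (a *: f) q = a * f q. Proof. by []. Qed.
Lemma Cinf1E q : (1 : Cinf M) q = 1. Proof. by []. Qed.
Lemma CinfXE f k q : (f ^+ k) q = f q ^+ k.
Proof. by elim: k => [|k IH]; rewrite ?expr0 ?exprS ?CinfME ?IH. Qed.
Lemma Cinf_sumE m (F : 'I_m -> Cinf M) q : (\sum_i F i) q = \sum_i F i q.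
Proof. by elim/big_rec2: _ => // i a b _ <-. Qed.
Lemma CinfP f g : (forall q, f q = g q) -> f = g.
Proof. by move=> fg; apply: val_inj; exact: funext. Qed.

Section Tangent.
Context {q : M}.
Implicit Types v w : tangent q.

Lemma tangentD v f g : v (f + g) = v f + v g.
Proof. by rewrite -[f]scale1r tangent_scalar scale1r mul1r. Qed.

Lemma tangent0 v : v 0 = 0.
Proof. by apply: (addrI (v 0)); rewrite -tangentD !addr0. Qed.

Lemma tangentZ v a f : v (a *: f) = a * v f.
Proof. by rewrite -[a *: f]addr0 tangent_scalar tangent0 addr0. Qed.

Lemma tangentB v f g : v (f - g) = v f - v g.
Proof. by rewrite -scaleN1r addrC tangent_scalar mulN1r addrC. Qed.

Lemma tangent_sum v m (F : 'I_m -> Cinf M) : v (\sum_i F i) = \sum_i v (F i).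
Proof.
by elim/big_rec2: _ => [|i a b _ <-]; [exact: tangent0|exact: tangentD].
Qed.

Lemma tangent1 v : v 1 = 0.
Proof.
apply: (addrI (v 1)); rewrite addr0 -[in RHS](mulr1 1) tangent_leibniz.
by rewrite Cinf1E mul1r.
Qed.

Lemma sum_tangentE m (u : 'I_m -> tangent q) f : (\sum_i u i) f = \sum_i u i f.
Proof. by elim/big_rec2: _ => // i a b _ <-. Qed.

Lemma tangentP v w : (forall f, v f = w f) -> v = w.
Proof. by move=> vw; apply: val_inj; exact: funext. Qed.

End Tangent.

Definition extend c (F : 'rV[R]_n -> R) q : R :=
  if `[< dom c q >] then F (coord c q) else 0.

Lemma extend_dom c F q : dom c q -> extend c F q = F (coord c q).
Proof. by rewrite /extend => /asboolT ->. Qed.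

Lemma extend_ndom c F q : ~ dom c q -> extend c F q = 0.
Proof. by rewrite /extend => /asboolF ->. Qed.

Lemma open_coord_image c (O : set M) : open O -> open (coord c @` (dom c `&` O)).
Proof.
move=> oO; rewrite openE => _ [q [cq Oq] <-].
have Vq : (coord c @` dom c) (coord c q) by exists q.
have n1 : nbhs (coord c q) (coord c @` dom c).
  exact: open_nbhs_nbhs (conj (@codom_open _ _ _ c) Vq).
have n2 : nbhs (coord c q) (param c @^-1` O).
  apply: (param_continuous Vq); rewrite coordK //.
  exact: open_nbhs_nbhs.
apply: filterS (filterI n1 n2) => _ [[r cr <-]] /=; rewrite coordK // => Or.
by exists r.
Qed.

Lemma smooth_extend c F K : atlas c -> smooth_on (coord c @` dom c) F ->
  compact K -> K `<=` coord c @` dom c -> (forall x, ~ K x -> F x = 0) ->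
  smooth (extend c F).
Proof.
move=> ac sF cK KV F0 d ad k; apply: Ck_local => _ [q dq <-].
have [cq|ncq] := pselect (dom c q).
  exists (coord d @` (dom d `&` dom c)); first by exists q.
  have oW := @open_coord_image d _ (dom_open c).
  apply: (@eq_Ck _ _ _ _ (F \o (fun x => coord c (param d x)))) => //.
    by move=> _ [r [dr cr] <-] /=; rewrite coordK // extend_dom.
  apply: (Ck_comp oW (@codom_open _ _ _ c) _ (sF k)).
    by move=> _ [r [dr cr] <-] /=; rewrite coordK //; exists r.
  by move=> j; exact: atlas_compatible.
pose L := param c @` K.
have cL : closed L.
  apply: compact_closed; first exact: carrier_hausdorff.
  apply: continuous_compact cK; apply: continuous_in_subspaceT => x /set_mem Kx.
  by apply: param_continuous; exact: KV.
have nL : ~ L q by move=> [x /KV[r cr <-] rq]; apply: ncq; rewrite -rq coordK.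
exists (coord d @` (dom d `&` ~` L)); first by exists q.
have oW := @open_coord_image d _ (closed_openC cL).
apply: (@eq_Ck _ _ _ _ (fun=> 0)) => //; last exact: Ck_cst.
move=> _ [r [dr Lr] <-] /=; rewrite coordK //.
have [cr|ncr] := pselect (dom c r); last by rewrite extend_ndom.
rewrite extend_dom // F0 // => Kr; apply: Lr.
by exists (coord c r) => //; rewrite coordK.
Qed.

(** [V] and the complement of [K] cover the space; on the latter the product is zero, whatever
    values [u] takes outside [V]. *)
Lemma smooth_on_cutoff (V K : set 'rV[R]_n) phi u : open V -> compact K ->
  K `<=` V -> (forall x, ~ K x -> phi x = 0) -> smooth_on setT phi ->
  smooth_on V u -> smooth_on setT (phi * u).
Proof.
move=> oV cK KV phi0 sphi su k; apply: Ck_local => x _.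
have [Vx|nVx] := pselect (V x).
  by exists V => //; apply: CkM => //; exact: CkS (sphi k).
have oK : open (~` K).
  by apply: closed_openC; apply: compact_closed => //; exact: norm_hausdorff.
exists (~` K); first by move=> /KV.
apply: (@eq_Ck _ _ _ _ (fun=> 0)) => //; last exact: Ck_cst.
by move=> y Ky; rewrite mulrfctE phi0 // mul0r.
Qed.

End Manifold.

(** * Global functions and fields that resolve tangent vectors near a point *)

Section Frames.
Context {R : realType} {n : nat} {M : smooth_manifold R n}.
Implicit Types (c : chart R n M) (f g : Cinf M) (q : M).

Definition pderiv c (i : 'I_n) f : 'rV[R]_n -> R := fun x => 'D_'e_i (f \o param c) x.

Lemma tangentDE q (u v : tangent q) f : (u + v) f = u f + v f. Proof. by []. Qed.
Lemma tangentNE q (u : tangent q) f : (- u) f = - u f. Proof. by []. Qed.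
Lemma tangentScE q a (u : tangent q) f : (a *: u) f = a * u f. Proof. by []. Qed.
Lemma vfieldZE g (X : vfield M) q : (g *: X) q = g q *: X q. Proof. by []. Qed.
Lemma vfield_sumE m (X : 'I_m -> vfield M) q : (\sum_i X i) q = \sum_i X i q.
Proof. by elim/big_rec2: _ => // i a b _ <-. Qed.

Lemma chart_nbhs c q : dom c q -> \forall x \near coord c q, (coord c @` dom c) x.
Proof.
move=> cq; apply: open_nbhs_nbhs.
by split; [exact: (@codom_open _ _ _ c)|exists q].
Qed.

Lemma derivable_chart c f i x : atlas c -> (coord c @` dom c) x ->
  derivable (f \o param c) x 'e_i.
Proof. by move=> ac Vx; exact: ((Cinf_smooth f ac 1%N).2 i).1. Qed.

Lemma smooth_on_pderiv c i f : atlas c -> smooth_on (coord c @` dom c) (pderiv c i f).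
Proof. by move=> ac k; exact: ((Cinf_smooth f ac k.+1).2 i).2. Qed.

Lemma smooth_onM (U : set 'rV[R]_n) (u v : 'rV[R]_n -> R) :
  open U -> smooth_on U u -> smooth_on U v -> smooth_on U (u * v).
Proof. by move=> oU su sv k; exact: CkM. Qed.

Section Cutoff.
Context {c : chart R n M} {phi : 'rV[R]_n -> R} {K : set 'rV[R]_n}.
Hypotheses (ac : atlas c) (sphi : smooth_on setT phi) (cK : compact K)
  (KV : K `<=` coord c @` dom c) (phi0 : forall x, ~ K x -> phi x = 0).

Lemma smooth_cutoff u : smooth_on (coord c @` dom c) u ->
  smooth (extend c (phi * u) : M -> R).
Proof.
move=> su; apply: (smooth_extend ac _ cK KV) => [|x Kx].
  by apply: smooth_onM => // [|k]; [exact: codom_open|exact: CkS (sphi k)].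
by rewrite mulrfctE phi0 // mul0r.
Qed.

Definition cutoff u su : Cinf M := mkCinf (@smooth_cutoff u su).

Lemma cutoff_dom u su q : dom c q ->
  @cutoff u su q = phi (coord c q) * u (coord c q).
Proof. by move=> cq; rewrite /= extend_dom. Qed.

Lemma cutoff_ndom u su q : ~ dom c q -> @cutoff u su q = 0.
Proof. by move=> cq; rewrite /= extend_ndom. Qed.

Lemma pderiv_cutoff u su i q : dom c q ->
  pderiv c i (@cutoff u su) (coord c q) =
  phi (coord c q) * 'D_'e_i u (coord c q) + u (coord c q) * 'D_'e_i phi (coord c q).
Proof.
move=> cq; have Vq : (coord c @` dom c) (coord c q) by exists q.
transitivity ('D_'e_i (phi * u) (coord c q)).
  apply: near_eq_derive; apply: filterS (chart_nbhs cq) => _ [r cr <-].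
  by rewrite /= coordK // extend_dom.
rewrite deriveM //; first exact: ((sphi 1%N).2 i).1.
exact: ((su 1%N).2 i).1.
Qed.

Fact cfield_subproof i q :
  (fun f => extend c (phi * pderiv c i f) q) \in derivation_at q.
Proof.
rewrite inE; have [cq|ncq] := pselect (dom c q); last first.
  by split=> [a f g|f g]; rewrite !extend_ndom // !mulr0 addr0.
have Vq : (coord c @` dom c) (coord c q) by exists q.
have df f : derivable (f \o param c) (coord c q) 'e_i by exact: derivable_chart.
split=> [a f g|f g]; rewrite !extend_dom // !mulrfctE /pderiv.
  rewrite -[Cinf_fun (a *: f + g) \o _]/(a *: (f \o param c) + (g \o param c)).
  rewrite deriveD ?deriveZ //; last exact: derivableZ.
  by rewrite /GRing.scale /=; ring.
rewrite -[Cinf_fun (f * g) \o _]/((f \o param c) * (g \o param c)).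
by rewrite deriveM // /GRing.scale /= coordK //; ring.
Qed.

(** The coordinate field of index [i] in the chart [c], multiplied by [phi] and extended by zero. *)
Definition cfield i : vfield M := @VField _ _ M
  (fun q => MkTangent (cfield_subproof i q))
  (fun f => smooth_cutoff (@smooth_on_pderiv c i f ac)).

Lemma cfield_dom i q f : dom c q ->
  cfield i q f = phi (coord c q) * pderiv c i f (coord c q).
Proof. exact: extend_dom. Qed.

Lemma cfield_ndom i q f : ~ dom c q -> cfield i q f = 0.
Proof. exact: extend_ndom. Qed.

End Cutoff.

(** Hadamard's lemma for the cut-off of [f - f q], multiplied by further cut-offs, becomes an
    identity of global functions to which [v] applies. At [q] the factors [f - f q] and [H i]
    vanish, so the Leibniz rule keeps only [v f] and the terms in [v (H i)]. *)
Lemma tangent_coord c q : atlas c -> dom c q ->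
  exists H : 'I_n -> Cinf M, forall (v : tangent q) f,
    v f = \sum_i pderiv c i f (coord c q) * v (H i).
Proof.
move=> ac cq; set x0 := coord c q.
have Vq : (coord c @` dom c) x0 by exists q.
have [phi [K [sphi phi1 cK KV phi0]]] := exists_bump (@codom_open _ _ _ c) Vq.
pose co u su := @cutoff c phi K ac sphi cK KV phi0 u su.
have s1 : smooth_on (coord c @` dom c) (fun=> 1 : R) by move=> k; exact: Ck_cst.
have sx i : smooth_on (coord c @` dom c) (fun x => x 0 i - x0 0 i).
  move=> k; apply: (@CkD _ _ _ _ (fun x => x 0 i) (cst (- x0 0 i)));
    [exact: codom_open|exact: Ck_coord|exact: Ck_cst].
pose chi := co _ s1.
pose H i := co _ (sx i).
exists H => v f.
pose w : 'rV[R]_n -> R := (f \o param c) - cst (f q).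
have sw : smooth_on (coord c @` dom c) w.
  move=> k; apply: CkD; [exact: codom_open|exact: Cinf_smooth|].
  exact: (Ck_cst _ _ (- f q)).
have su : smooth_on setT (phi * w).
  exact: smooth_on_cutoff (@codom_open _ _ _ c) cK KV phi0 sphi sw.
have [g [sg g0 gE]] := hadamard x0 su.
have sgV i : smooth_on (coord c @` dom c) (g i) by move=> k; exact: CkS (sg i k).
pose G i := co _ (sgV i).
have w0 : w x0 = 0.
  by rewrite /w -[LHS]/(f (param c x0) - f q) /x0 coordK // subrr.
(* One factor [chi] comes from the function [phi * w] that Hadamard's lemma decomposes, the other
   two from [H i] and [G i]. *)
have E : chi ^+ 3 * (f - f q *: (1 : Cinf M)) = \sum_i H i * G i.
  apply: CinfP => r; rewrite Cinf_sumE CinfME CinfXE CinfBE CinfZE Cinf1E mulr1.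
  have [cr|ncr] := pselect (dom c r); last first.
    rewrite cutoff_ndom // expr0n mul0r big1 // => i _.
    by rewrite CinfME !cutoff_ndom // mul0r.
  under eq_bigr do rewrite CinfME !cutoff_dom // mulrACA.
  rewrite -mulr_sumr.
  have := gE (coord c r); rewrite !mulrfctE w0 mulr0 add0r => <-.
  rewrite cutoff_dom // mulr1 /w -[(_ - _) (coord c r)]/(f (param c (coord c r)) - f q).
  by rewrite coordK //; ring.
have chi1 : chi q = 1 by rewrite cutoff_dom // mulr1.
have H0 i : H i q = 0 by rewrite cutoff_dom // subrr mulr0.
have := congr1 v E; rewrite tangent_leibniz CinfXE chi1 expr1n mul1r.
rewrite CinfBE CinfZE Cinf1E mulr1 subrr mul0r addr0 tangentB tangentZ tangent1.
rewrite mulr0 subr0 => ->; rewrite tangent_sum; apply: eq_bigr => i _.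
rewrite tangent_leibniz H0 mul0r add0r cutoff_dom // phi1 mul1r g0.
(* Since [w x0 = 0] and [phi x0 = 1], the derivative of [phi * w] at [x0] is that of [w]. *)
congr (_ * _); rewrite deriveM //; last 2 first.
- exact: ((sphi 1%N).2 i).1.
- exact: ((sw 1%N).2 i).1.
rewrite w0 scale0r addr0 phi1 scale1r deriveB ?derive_cst ?subr0 //.
exact: derivable_chart.
Qed.

(** This serves to prove identities at [p]: after multiplication by [rho] an arbitrary field or form
    becomes a finite combination of the [F i] or of the differentials of the [h i], and then
    [rho p = 1] removes the factor. *)
Lemma exists_frame (p : M) : exists m (rho : Cinf M) (h : 'I_m -> Cinf M)
    (F : 'I_m -> vfield M), rho p = 1 /\
  forall q (v : tangent q), rho q *: v = \sum_i v (h i) *: F i q.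
Proof.
have [c ac cp] := atlas_cover p.
have Vp : (coord c @` dom c) (coord c p) by exists p.
have [phi [K [sphi phi1 cK KV phi0]]] := exists_bump (@codom_open _ _ _ c) Vp.
pose co u su := @cutoff c phi K ac sphi cK KV phi0 u su.
have s1 : smooth_on (coord c @` dom c) (fun=> 1 : R) by move=> k; exact: Ck_cst.
have sx i : smooth_on (coord c @` dom c) (fun x : 'rV[R]_n => x 0 i : R).
  by move=> k; exact: Ck_coord.
pose chi := co _ s1; pose xi i := co _ (sx i).
pose E i := @cfield c phi K ac sphi cK KV phi0 i.
(* Index [ord0] belongs to [chi], the others to the cut-off coordinates [xi]. The fields are chosen
   so that the sum has coefficient [chi q * v (xi i) - xi i q * v chi] on [E i]; this is [phi ^ 2]
   times a component of [v], and [E i] carries the third factor of [phi]. *)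
exists n.+1, (chi ^+ 3), (fun j => oapp xi chi (unlift ord0 j)),
  (fun j => oapp (fun i => chi *: E i) (- \sum_i xi i *: E i) (unlift ord0 j)).
split=> [|q v]; first by rewrite CinfXE cutoff_dom // phi1 mulr1 expr1n.
rewrite big_ord_recl unlift_none.
rewrite [X in _ = _ + X](_ : _ = \sum_i v (xi i) *: (chi *: E i) q); last first.
  by apply: eq_bigr => i _; rewrite liftK.
apply: tangentP => f; rewrite [oapp _ _ _]/= [oapp _ _ _]/=.
transitivity (\sum_i (chi q * v (xi i) - xi i q * v chi) * E i q f); last first.
  rewrite tangentDE tangentScE tangentNE vfield_sumE !sum_tangentE mulrN -mulNr.
  rewrite mulr_sumr -big_split; apply: eq_bigr => i _.
  rewrite -[RHS]/(_ + _) !vfieldZE !tangentScE; ring.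
rewrite tangentScE CinfXE.
have [cq|ncq] := pselect (dom c q); last first.
  rewrite cutoff_ndom // expr0n mul0r big1 // => i _.
  by rewrite cfield_ndom // mulr0.
have [H vH] := tangent_coord ac cq.
(* [v (H i)] is the [i]-th component of [v]; since [phi] need not be constant
   near [coord c q], it has to be recovered from [xi] and [chi] by the product
   rule. *)
have vx i : chi q * v (xi i) - xi i q * v chi = phi (coord c q) ^+ 2 * v (H i).
  rewrite !cutoff_dom // (vH v (xi i)) (vH v chi) !mulr_sumr -sumrB.
  rewrite (bigD1 i) //= big1 => [|j ji].
    rewrite !pderiv_cutoff // derive_cst derive_coord eqxx /=; ring.
  rewrite !pderiv_cutoff // derive_cst derive_coord [i == j]eq_sym (negbTE ji) /=; ring.
under eq_bigr do rewrite vx cfield_dom //.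
rewrite cutoff_dom // mulr1 (vH v f) mulr_sumr; apply: eq_bigr => i _; ring.
Qed.

End Frames.

(** * Tensoriality *)

Section Tensoriality.
Context {R : realType} {n : nat} {M : smooth_manifold R n}.
Implicit Types (X Y Z : vfield M) (f g : Cinf M) (q : M).

Lemma lie_derivDl X Y f : lie_deriv (X + Y) f = lie_deriv X f + lie_deriv Y f.
Proof. exact: CinfP. Qed.

Lemma lie_derivBl X Y f : lie_deriv (X - Y) f = lie_deriv X f - lie_deriv Y f.
Proof. exact: CinfP. Qed.

Lemma lie_derivZl g X f : lie_deriv (g *: X) f = g * lie_deriv X f.
Proof. exact: CinfP. Qed.

Lemma lie_deriv_suml m (X : 'I_m -> vfield M) f :
  lie_deriv (\sum_i X i) f = \sum_i lie_deriv (X i) f.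
Proof.
by apply: CinfP => q; rewrite Cinf_sumE /= vfield_sumE sum_tangentE.
Qed.

Lemma lie_deriv_sumr X m (f : 'I_m -> Cinf M) :
  lie_deriv X (\sum_i f i) = \sum_i lie_deriv X (f i).
Proof. by apply: CinfP => q; rewrite Cinf_sumE /= tangent_sum. Qed.

Lemma lie_derivDr X f g : lie_deriv X (f + g) = lie_deriv X f + lie_deriv X g.
Proof. by rewrite -[f]scale1r lie_deriv_linear !scale1r. Qed.

Definition pairing (a : oneform M) X : Cinf M := mkCinf (oneform_smooth a X).

Lemma cotangent_scalar q (a : cotangent q) : scalar a.
Proof. by have := cotangent_subproof a; rewrite inE. Qed.

Lemma cotangentD q (a : cotangent q) u v : a (u + v) = a u + a v.
Proof. by rewrite -[u]scale1r cotangent_scalar scale1r mul1r. Qed.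

Lemma cotangent0 q (a : cotangent q) : a 0 = 0.
Proof. by apply: (addrI (a 0)); rewrite -cotangentD !addr0. Qed.

Lemma cotangentZ q (a : cotangent q) k u : a (k *: u) = k * a u.
Proof. by rewrite -[k *: u]addr0 cotangent_scalar cotangent0 addr0. Qed.

Lemma cotangent_sum q (a : cotangent q) m (u : 'I_m -> tangent q) :
  a (\sum_i u i) = \sum_i a (u i).
Proof.
by elim/big_rec2: _ => [|i x y _ <-]; [exact: cotangent0|exact: cotangentD].
Qed.

Lemma sum_cotangentE q m (a : 'I_m -> cotangent q) u :
  (\sum_i a i) u = \sum_i a i u.
Proof. by elim/big_rec2: _ => // i x y _ <-. Qed.

Lemma pairingD a X Y : pairing a (X + Y) = pairing a X + pairing a Y.
Proof. by apply: CinfP => q; exact: cotangentD. Qed.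

Lemma pairingZ a g X : pairing a (g *: X) = g * pairing a X.
Proof. by apply: CinfP => q; exact: cotangentZ. Qed.

(** A decomposition of [rho] times the identity of the tangent bundle as a sum of the tensors [dh_i]
    times [F_i]; the [F i] may be linearly dependent. *)
Definition is_frame m (rho : Cinf M) (h : 'I_m -> Cinf M) (F : 'I_m -> vfield M) :=
  forall q (v : tangent q), rho q *: v = \sum_i v (h i) *: F i q.

Section Frame.
Context {m : nat} {rho : Cinf M} {h : 'I_m -> Cinf M} {F : 'I_m -> vfield M}.
Hypothesis fr : is_frame rho h F.

Lemma frame_vfield X : rho *: X = \sum_i lie_deriv X (h i) *: F i.
Proof.
apply: vfieldP => q f.
by rewrite vfield_sumE vfieldZE fr !sum_tangentE; apply: eq_bigr.
Qed.

Lemma frame_cotangent q (a : cotangent q) :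
  rho q *: a = \sum_i a (F i q) *: diff_at q (h i).
Proof.
apply: val_inj; apply: funext => v.
transitivity (a (rho q *: v)); first by rewrite cotangentZ.
rewrite fr cotangent_sum; transitivity (\sum_i (a (F i q) *: diff_at q (h i)) v).
  by apply: eq_bigr => i _; rewrite cotangentZ mulrC.
by rewrite -sum_cotangentE.
Qed.

Lemma frame_pairing a X :
  rho * pairing a X = \sum_i pairing a (F i) * lie_deriv X (h i).
Proof.
apply: CinfP => q; rewrite Cinf_sumE; transitivity ((rho q *: a q) (X q)) => //.
by rewrite frame_cotangent sum_cotangentE; apply: eq_bigr.
Qed.

End Frame.

(** Expanding [rho *: X] in a frame shows that [Phi X q] depends on [X] only through [X q], by an
    explicit linear form. These forms are chosen separately at each point; smoothness holds because
    it is tested on fields, where the pairing is [Phi X]. *)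
Lemma tensorial_oneform (Phi : vfield M -> Cinf M) :
  {morph Phi : X Y / X + Y} -> (forall g X, Phi (g *: X) = g * Phi X) ->
  exists a : oneform M, forall X q, a q (X q) = Phi X q.
Proof.
move=> PhiD PhiZ.
have Phi0 : Phi 0 = 0 by rewrite -[0](scale0r 0) PhiZ mul0r.
have H q : exists a : cotangent q, forall X, a (X q) = Phi X q.
  have [m [rho [h [F [rho1 fr]]]]] := exists_frame q.
  have lin : (fun v : tangent q => \sum_i v (h i) * Phi (F i) q)
      \in cotangent_pred (p := q).
    rewrite inE => k u v; rewrite mulr_sumr -big_split; apply: eq_bigr => i _.
    by rewrite tangentDE tangentScE mulrDl mulrA.
  exists (MkCotangent lin) => X /=.
  transitivity (Phi (rho *: X) q); last by rewrite PhiZ CinfME rho1 mul1r.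
  rewrite (frame_vfield fr) (big_morph Phi PhiD Phi0) Cinf_sumE.
  by apply: eq_bigr => i _; rewrite PhiZ.
have sP X : smooth (fun q => sval (cid (H q)) (X q)).
  have -> : (fun q => sval (cid (H q)) (X q)) = Phi X.
    by apply/funext => q; exact: (svalP (cid (H q))).
  exact: Cinf_smooth.
exists (@OneForm _ _ _ (fun q => sval (cid (H q))) sP) => X q.
exact: (svalP (cid (H q))).
Qed.

Section Sharp.
Variable theta : sym_bivector M.

Lemma bivectorDr q (a b c : cotangent q) : theta q a (b + c) = theta q a b + theta q a c.
Proof. by rewrite -[b]scale1r bivector_linear scale1r mul1r. Qed.

Lemma bivector0r q (a : cotangent q) : theta q a 0 = 0.
Proof. by apply: (addrI (theta q a 0)); rewrite -bivectorDr !addr0. Qed.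

Lemma bivectorZr q (a : cotangent q) k b : theta q a (k *: b) = k * theta q a b.
Proof. by rewrite -[k *: b]addr0 bivector_linear bivector0r addr0. Qed.

Lemma bivector_sumr q (a : cotangent q) m (b : 'I_m -> cotangent q) :
  theta q a (\sum_i b i) = \sum_i theta q a (b i).
Proof.
by elim/big_rec2: _ => [|i x y _ <-]; [exact: bivector0r|exact: bivectorDr].
Qed.

(** [sharp_at] is defined by its values on functions, that is, by pairing with differentials; a
    frame writes every covector at [q] as a combination of differentials. *)
Lemma sharp_atE q (a b : cotangent q) : b (sharp_at theta a) = theta q a b.
Proof.
have [m [rho [h [F [rho1 fr]]]]] := exists_frame q.
have /(congr1 (fun c => theta q a c)) := frame_cotangent fr b.
rewrite rho1 scale1r => ->; rewrite bivector_sumr.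
rewrite -[sharp_at theta a]scale1r -rho1 fr cotangent_sum.
by apply: eq_bigr => i _; rewrite cotangentZ bivectorZr mulrC.
Qed.

(** Locally the gradients generate the characteristic module, which reduces statements about
    [sharp theta a] to gradients. *)
Lemma frame_sharp m rho (h : 'I_m -> Cinf M) F (a : oneform M) :
  is_frame rho h F ->
  rho *: sharp theta a = \sum_i pairing a (F i) *: gradient theta (h i).
Proof.
move=> fr; apply: vfieldP => q f.
rewrite vfield_sumE sum_tangentE.
transitivity (theta q (diff_at q f) (rho q *: a q)).
  by rewrite bivectorZr bivector_sym.
rewrite (frame_cotangent fr) bivector_sumr; apply: eq_bigr => i _.
by rewrite bivectorZr bivector_sym.
Qed.

End Sharp.
End Tensoriality.

(** * Parallelism of the bivector and involutivity *)

Section StrongSymmetricPoisson.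
Context {R : realType} {n : nat} {M : smooth_manifold R n}.
Implicit Types (X Y Z : vfield M) (f g : Cinf M) (q : M).
Variables (theta : sym_bivector M) (nabla : affine_connection M).
Hypotheses (nabla_tf : torsion_free nabla)
  (theta_nabla : strong_sym_poisson theta nabla).
Local Notation grad := (gradient theta).
Local Notation "'L'" := lie_deriv.

Lemma nablaDl X Y Z : nabla (X + Y) Z = nabla X Z + nabla Y Z.
Proof. by have := nabla_linearl nabla Z 1 X Y; rewrite !scale1r. Qed.

Lemma nablaZl g X Z : nabla (g *: X) Z = g *: nabla X Z.
Proof.
have n0 : nabla 0 Z = 0 by apply: (addrI (nabla 0 Z)); rewrite -nablaDl !addr0.
by have := nabla_linearl nabla Z g X 0; rewrite n0 !addr0.
Qed.

Lemma nabla_suml m (X : 'I_m -> vfield M) Z :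
  nabla (\sum_i X i) Z = \sum_i nabla (X i) Z.
Proof.
have n0 : nabla 0 Z = 0 by apply: (addrI (nabla 0 Z)); rewrite -nablaDl !addr0.
by elim/big_rec2: _ => // i x y _ <-; exact: nablaDl.
Qed.

Lemma nabla_sumr X m (Z : 'I_m -> vfield M) :
  nabla X (\sum_i Z i) = \sum_i nabla X (Z i).
Proof.
have n0 : nabla X 0 = 0 by apply: (addrI (nabla X 0)); rewrite -nablaDr !addr0.
by elim/big_rec2: _ => // i x y _ <-; exact: nablaDr.
Qed.

(* The strong condition and the vanishing of the torsion determine
   [nabla (grad f) (grad h)] by a Koszul formula. *)
Lemma nabla_theta_exact f g h :
  L (nabla (grad f) (grad g)) h + L (nabla (grad f) (grad h)) g =
  L (grad f) (L (grad h) g).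
Proof.
have S a b c : L (nabla (grad a) (grad b)) c + L (nabla (grad b) (grad a)) c =
    L (grad c) (L (grad a) b).
  rewrite -lie_derivDl -[_ + _]/(sym_bracket nabla _ _) -theta_nabla.
  by apply: CinfP => q; exact: bivector_sym.
have T a b c : L (nabla (grad a) (grad b)) c - L (nabla (grad b) (grad a)) c =
    L (grad a) (L (grad b) c) - L (grad b) (L (grad a) c).
  by rewrite -lie_derivBl nabla_tf; exact: CinfP.
have B a b : L (grad a) b = L (grad b) a.
  by apply: CinfP => q; exact: bivector_sym.
apply: CinfP => q.
have E a b : a = b -> (a : Cinf M) q = b q by move=> ->.
(* In the sum of these four identities the brackets differentiated along [grad g] and [grad h]
   cancel, which leaves twice the claim. *)
have := (E _ _ (S f g h), E _ _ (S f h g), E _ _ (T f g h), E _ _ (T f h g)).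
rewrite (B g h) !CinfDE !CinfNE => -[[[s1 s2] t1] t2]; lra.
Qed.

(** Every term is linear over functions in the differentiating field, so [nabla_theta_exact] passes
    from gradients to [sharp theta a] through [frame_sharp]. *)
Lemma nabla_theta_exactr (a : oneform M) g h :
  L (nabla (sharp theta a) (grad g)) h + L (nabla (sharp theta a) (grad h)) g =
  L (sharp theta a) (L (grad h) g).
Proof.
apply: CinfP => p.
have [m [rho [k [F [rho1 fr]]]]] := exists_frame p.
have H : rho * (L (nabla (sharp theta a) (grad g)) h +
    L (nabla (sharp theta a) (grad h)) g) = rho * L (sharp theta a) (L (grad h) g).
  rewrite mulrDr -!lie_derivZl -!nablaZl (frame_sharp theta a fr) !nabla_suml.
  rewrite !lie_deriv_suml -big_split; apply: eq_bigr => i _.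
  by rewrite !nablaZl !lie_derivZl -nabla_theta_exact mulrDr.
by have := congr1 (fun u : Cinf M => u p) H; rewrite !CinfME rho1 !mul1r.
Qed.

(** With [X = sharp theta a] this says that the covariant derivative of [theta] along [X] vanishes
    on the pair [b], [dg]. It extends [nabla_theta_exactr] from [grad h] to [sharp theta b]. *)
Lemma nabla_theta (a b : oneform M) g :
  L (nabla (sharp theta a) (sharp theta b)) g +
    pairing b (nabla (sharp theta a) (grad g)) =
  L (sharp theta a) (L (sharp theta b) g).
Proof.
set X := sharp theta a; set Z := sharp theta b.
apply: CinfP => p.
have [m [rho [k [F [rho1 fr]]]]] := exists_frame p.
have EZ := frame_sharp theta b fr; rewrite -/Z in EZ.
pose c i := pairing b (F i).
(* The single terms are not linear over functions in [Z], but [E1] and [E2] produce the same Leibniz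
   terms, with [L X rho] and with [L X (c i)], and these cancel in [H]. *)
have E1 : rho * L (nabla X Z) g + L X rho * L Z g =
    \sum_i (c i * L (nabla X (grad (k i))) g + L X (c i) * L (grad (k i)) g).
  rewrite -!lie_derivZl -lie_derivDl -nabla_leibniz EZ nabla_sumr lie_deriv_suml.
  by apply: eq_bigr => i _; rewrite nabla_leibniz lie_derivDl !lie_derivZl.
have E2 : rho * L X (L Z g) + L X rho * L Z g =
    \sum_i (c i * L X (L (grad (k i)) g) + L X (c i) * L (grad (k i)) g).
  rewrite [L X rho * _]mulrC -lie_deriv_leibniz -lie_derivZl EZ lie_deriv_suml.
  rewrite lie_deriv_sumr; apply: eq_bigr => i _.
  by rewrite lie_derivZl lie_deriv_leibniz [L X _ * _]mulrC.
have E3 := frame_pairing fr b (nabla X (grad g)).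
have H : rho * (L (nabla X Z) g + pairing b (nabla X (grad g))) = rho * L X (L Z g).
  apply: (addIr (L X rho * L Z g)); rewrite E2 mulrDr addrAC E1 E3 -big_split.
  apply: eq_bigr => i _; rewrite -nabla_theta_exactr -/X /c.
  by rewrite -[LHS]/(_ + _) addrAC mulrDr; congr (_ + _); exact: addrC.
by have := congr1 (fun u : Cinf M => u p) H; rewrite !CinfME rho1 !mul1r.
Qed.

Lemma involutive_char_module : is_involutive (char_module theta).
Proof.
move=> _ _ [a ->] [b ->].
(* [D X c] is the covariant derivative of the 1-form [c] along [X], evaluated on [Y]. *)
pose D X c Y := L X (pairing c Y) - pairing c (nabla X Y).
have DD X c : {morph D X c : Y Z / Y + Z}.
  by move=> Y Z; rewrite /D nablaDr !pairingD lie_derivDr opprD addrACA.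
have DZ X c g Y : D X c (g *: Y) = g * D X c Y.
  rewrite /D nabla_leibniz pairingD !pairingZ lie_deriv_leibniz.
  by apply: CinfP => q; rewrite !(CinfDE, CinfNE, CinfME) /=; ring.
pose A := sharp theta a; pose B := sharp theta b.
(* The form [c] is the covariant derivative of [b] along [A] minus that of [a] along [B]; its image
   under [theta] will be the Lie bracket. *)
have [|g Y|c cE] := @tensorial_oneform _ _ _ (fun Y => D A b Y - D B a Y).
- by move=> Y Z; rewrite !DD opprD addrACA.
- rewrite !DZ; exact: esym (mulrBr _ _ _).
(* Parallelism of [theta]: the image under [theta] of the covariant derivative of [e'] is the
   covariant derivative of [sharp theta e'], here tested on [g]. *)
have Dgrad e e' g : D (sharp theta e) e' (grad g) =
    L (nabla (sharp theta e) (sharp theta e')) g.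
  apply/eqP; rewrite /D subr_eq nabla_theta; apply/eqP.
  congr (L _ _); apply: CinfP => q.
  by rewrite -[LHS]/(e' q (sharp_at theta (diff_at q g))) sharp_atE bivector_sym.
exists c; apply: vfieldP => q g.
rewrite -nabla_tf -[RHS]/(theta q (c q) (diff_at q g)) bivector_sym -sharp_atE.
by rewrite -[RHS]/(c q (grad g q)) cE CinfDE CinfNE !Dgrad.
Qed.

End StrongSymmetricPoisson.

Theorem proposition5p1 (R : realType) (n : nat) (M : smooth_manifold R n)
  (theta : sym_bivector M) (nabla : affine_connection M)
  (nabla_tf : torsion_free nabla)
  (theta_nabla : strong_sym_poisson theta nabla) :
  is_involutive (char_module theta).
Proof. exact: involutive_char_module nabla_tf theta_nabla. Qed.
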